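(* Let $d\geq 2$ be an integer. Then there exists an effectively computable number $\mathbf{S}(d)\in(1/2,1)$, which tends to $1$ as $d$ tends to infinity, such that, for any $\mathbf{S}(d)<\sigma\leq 1$, any $t\in\mathbb{R}$ (with $s:=\sigma+it$) and almost every $(a_1,a_2,\dots,a_d)\in[0,+\infty)^d$, $$\lim_{N\to\infty}\frac{1}{N}\sum_{n=1}^{N}\left|\zeta\left(s+i\left(a_1n+a_2n^2+\dots+a_dn^d\right)\right)\right|^2=\zeta(2\sigma).$$
   Context: $\zeta$ denotes the Riemann zeta-function (meromorphically continued to $\mathbb{C}$) and $s=\sigma+it$ denotes a complex variable with real part $\sigma$ and imaginary part $t$. ''Almost every'' is with respect to Lebesgue measure on $[0,+\infty)^d$. *)

(* Defs.v *)
From HB Require Import structures.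
From mathcomp Require Import all_boot all_order all_algebra.
From mathcomp Require Import all_classical all_reals all_analysis.
From mathcomp Require Import complex.

Set Implicit Arguments.
Unset Strict Implicit.
Unset Printing Implicit Defensive.

Import Order.TTheory GRing.Theory Num.Theory.
Import numFieldNormedType.Exports.

Local Open Scope classical_set_scope.
Local Open Scope ring_scope.
Local Open Scope complex_scope.

(* R[i] itself carries no topology; R[i]^o is the same type with the topology of
   the modulus. *)
Section complex_analysis.
Variable R : realType.
Implicit Types (f : R[i] -> R[i]) (c : nat -> R[i]) (z : R[i]).

Definition cexp z : R[i] :=
  (expR (complex.Re z))%:C * (cos (complex.Im z) +i* sin (complex.Im z)).

Definition cseries_to c z : Prop := @series R[i]^o c @ \oo --> (z : R[i]^o).

Definition analytic_at f z0 : Prop :=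
  exists c, \forall z \near (z0 : R[i]^o),
    cseries_to (fun k => c k * (z - z0) ^+ k) (f z).

(* Near z0, f is the sum of a Laurent series with finite principal part:
   f z = (z - z0)^(-m) \sum_k c_k (z - z0)^k on a punctured disc. *)
Definition meromorphic_at f z0 : Prop :=
  exists (m : nat) c, \forall z \near (z0 : R[i]^o)^',
    cseries_to (fun k => c k * (z - z0) ^+ k) ((z - z0) ^+ m * f z).

(* The n-th term of the Dirichlet series is n.+1 ^ (- s). The value at s = 1 is
   left free; everywhere else the three clauses determine zeta. *)
Definition is_riemann_zeta (zeta : R[i] -> R[i]) : Prop :=
  [/\ forall s, 1 < complex.Re s ->
        cseries_to (fun n => cexp (- s * (ln n.+1%:R)%:C)) (zeta s),
      forall s, s != 1 -> analytic_at zeta s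
    & meromorphic_at zeta 1].

End complex_analysis.

Section lebesgue_cons.
Variables (R : realType) (n : nat).
Notation T := (measurableTypeR R).

Definition tuple_cons (p : T * n.-tuple T) : n.+1.-tuple T :=
  [the n.+1.-tuple T of p.1 :: p.2].

Lemma measurable_tuple_cons : measurable_fun setT tuple_cons.
Proof. by apply: measurable_cons. Qed.

Definition tuple_uncons (t : n.+1.-tuple T) : T * n.-tuple T :=
  (thead t, [tuple of behead t]).

Lemma measurable_tuple_uncons : measurable_fun setT tuple_uncons.
Proof.
apply/measurable_fun_pairP; split => /=; first exact: measurable_tnth.
exact: measurable_behead.
Qed.

Lemma tuple_consK : cancel tuple_cons tuple_uncons.
Proof. by case=> x t; congr (_, _); apply: val_inj. Qed.

Variable mu : {sigma_finite_measure set (n.-tuple T) -> \bar R}.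

Definition lebesgue_cons : set (n.+1.-tuple T) -> \bar R :=
  pushforward (@lebesgue_measure R \x mu)%E tuple_cons.

Let lebesgue_cons0 : lebesgue_cons set0 = 0%E.
Proof. by rewrite /lebesgue_cons /pushforward preimage_set0 measure0. Qed.

Let lebesgue_cons_ge0 A : (0 <= lebesgue_cons A)%E.
Proof. exact: (measure_ge0 (@lebesgue_measure R \x mu)%E). Qed.

Let lebesgue_cons_sigma_additive : semi_sigma_additive lebesgue_cons.
Proof.
exact: (@measure_semi_sigma_additive _ _ _
  (measure_function_pushforward__canonical__measure_function_Measure
     (@lebesgue_measure R \x mu)%E measurable_tuple_cons)).
Qed.

HB.instance Definition _ := isMeasure.Build _ _ _ lebesgue_cons
  lebesgue_cons0 lebesgue_cons_ge0 lebesgue_cons_sigma_additive.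

Let lebesgue_cons_sigma_finite : sigma_finite setT lebesgue_cons.
Proof.
have /sigma_finiteP[F [TF ndF Foo]] := sigma_finiteT (@lebesgue_measure R).
have /sigma_finiteP[G [TG ndG Goo]] := sigma_finiteT mu.
exists (fun k => tuple_uncons @^-1` (F k `*` G k)).
  rewrite -preimage_bigcup (_ : \bigcup_k _ = setT) ?preimage_setT//.
  apply/seteqP; split=> // -[x y] _.
  have [k _ Fkx] : (\bigcup_i F i) x by rewrite -TF.
  have [l _ Gly] : (\bigcup_i G i) y by rewrite -TG.
  exists (maxn k l) => //; split.
  - by move: x Fkx; exact/subsetPset/ndF/leq_maxl.
  - by move: y Gly; exact/subsetPset/ndG/leq_maxr.
move=> k; have [mF Fk] := Foo k; have [mG Gk] := Goo k; split.
  rewrite -[X in measurable X]setTI; apply: measurable_tuple_uncons => //.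
  exact: measurableX.
rewrite /lebesgue_cons /pushforward -comp_preimage.
rewrite (_ : _ \o _ = idfun); last by apply/funext => p /=; rewrite tuple_consK.
rewrite preimage_id (product_measure1E (@lebesgue_measure R))//.
by rewrite lte_mul_pinfty// ge0_fin_numE.
Qed.

HB.instance Definition _ := Measure_isSigmaFinite.Build _ _ _ lebesgue_cons
  lebesgue_cons_sigma_finite.

End lebesgue_cons.

(* Lebesgue measure on R^d, as the iterated product of lebesgue_measure. *)
Fixpoint lebesgue_tuple (R : realType) (d : nat) :
    {sigma_finite_measure set (d.-tuple (measurableTypeR R)) -> \bar R} :=
  match d with
  | 0 => [the {sigma_finite_measure set _ -> \bar R} of
            \d_([tuple] : 0.-tuple (measurableTypeR R))]
  | n.+1 => [the {sigma_finite_measure set _ -> \bar R} of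
            lebesgue_cons (lebesgue_tuple R n)]
  end.

(* The total recursive functions nat^k -> nat: minimization is only applied
   when it always finds a zero. *)
Inductive recursive : forall k : nat, (k.-tuple nat -> nat) -> Prop :=
| recursive_zero k : recursive (fun _ : k.-tuple nat => 0%N)
| recursive_succ : recursive (fun v : 1.-tuple nat => (thead v).+1)
| recursive_proj k (i : 'I_k) : recursive (fun v : k.-tuple nat => tnth v i)
| recursive_comp k m (g : m.-tuple nat -> nat)
    (f : 'I_m -> k.-tuple nat -> nat) :
    recursive g -> (forall i, recursive (f i)) ->
    recursive (fun v : k.-tuple nat => g [tuple f i v | i < m])
| recursive_primrec k (f : k.-tuple nat -> nat) (g : k.+2.-tuple nat -> nat)
    (h : k.+1.-tuple nat -> nat) :
    recursive f -> recursive g ->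
    (forall v : k.-tuple nat, h [tuple of 0%N :: v] = f v) ->
    (forall n (v : k.-tuple nat), h [tuple of n.+1 :: v] =
       g [tuple of n :: h [tuple of n :: v] :: v]) ->
    recursive h
| recursive_mu k (g : k.+1.-tuple nat -> nat) (h : k.-tuple nat -> nat) :
    recursive g ->
    (forall v : k.-tuple nat, g [tuple of h v :: v] = 0%N) ->
    (forall (v : k.-tuple nat) n, (n < h v)%N -> g [tuple of n :: v] <> 0%N) ->
    recursive h.

(* Uniform computability of a sequence of reals: one algorithm returns, from n
   and k, a rational within 2^-k of x n. *)
Definition computable_real_seq (R : realType) (x : nat -> R) : Prop :=
  exists s p q : 2.-tuple nat -> nat,
    [/\ recursive s, recursive p, recursive q
      & forall n k, let v := [tuple n; k] in
        `|x n - (-1) ^+ s v * (p v)%:R / (q v).+1%:R| <= 2 ^- k].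

(* Main.v *)
(** Put [tau n = t + a_1 n + ... + a_d n ^ d].  Two facts are combined.

    First, for [1/2 <= sigma <= 1], comparing [n ^ (- s)] with the integral of
    [x ^ (- s)] approximates [zeta (sigma + i tau)] by the partial sum of its
    Dirichlet series up to [K], with an error
    [O (K ^ (1 - sigma) / |tau| + |tau| K ^ (- sigma))].  With
    [K = n ^ (2 (d + 1))] and [sigma] close to 1 this tends to 0 along [tau n].

    Second, the square of the modulus of that partial sum is the diagonal
    [\sum_(k < K) k ^ (- 2 sigma)], which tends to [zeta (2 sigma)], plus a
    trigonometric polynomial in [tau n] with frequencies [ln (k / l)], [k != l].
    Fix [a_2, ..., a_d] and integrate over [a_1] in [0, A] the square of the mean
    over [n <= N] of these off-diagonal parts.  Each product of two terms
    integrates to at most [min (A, 2 / |n th + m th'|)], and for fixed [n] the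
    numbers [n th + m th'] are spaced by [|th'|], so that the sum over [m] is
    [O (A + log N / |th'|)] and not [O (N)].  For [sigma > 1 - 1 / (32 (d + 1))]
    this gives a mean square of order [N ^ (- 1/2)], hence almost sure
    convergence to 0 along [N = j ^ 4]; monotonicity of the partial sums gives
    all [N]. *)
Require Import Defs.
From mathcomp Require Import all_boot all_order all_algebra.
From mathcomp Require Import all_classical all_reals all_analysis.
From mathcomp Require Import measurable_realfun complex.
From mathcomp Require Import zify ring lra.
Set Implicit Arguments.
Unset Strict Implicit.
Unset Printing Implicit Defensive.
Import Order.TTheory GRing.Theory Num.Theory.
Import numFieldNormedType.Exports.
Local Open Scope classical_set_scope.
Local Open Scope ring_scope.

(** * Sequences, means and power series *)

(** Inside the critical strip [is_riemann_zeta] gives only local analyticity, so the approximation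
    of zeta there needs a continuation argument. The series of (1 - s) n^(-s) - ((n + 1)^(1 - s) -
    n^(1 - s)) converges for positive real part. It is identified with (1 - s) zeta(s) + 1 along
    each horizontal line of nonzero ordinate, which misses the pole: in the real part both sides are
    locally real power series, and a one-variable identity theorem suffices. The constants come from
    Q = 2 (d + 1), K = n^Q. Since |tau n| is O(n^d) and sigma > 1/2, the error |tau| K^(-sigma) is
    O(1/n). Almost every a_1 is positive, so |tau n| grows at least linearly, and the other error
    vanishes once Q (1 - sigma) < 1. The mean square asks for more: the weights k^(-sigma) are at
    most kappa / k with kappa = K^(1 - sigma), K = N^Q, and the estimate carries kappa^4. The
    condition 16 Q (1 - sigma) <= 1 keeps kappa^4 below N^(1/4), which leaves room for five
    logarithmic factors in the summable bound j^(-2) along N = j^4. *)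

Section sequences.
Variable R : realType.
Implicit Types (u v : nat -> R) (l x : R).

Lemma cvg_epsP u l : u @ \oo --> l <->
  forall e, 0 < e -> exists N : nat, forall n, (N <= n)%N -> `|l - u n| <= e.
Proof.
split=> [/cvgrPdist_le h e e0|h].
  by have [N _ HN] := h e e0; exists N => n Nn; apply: HN.
apply/cvgrPdist_le => e e0; have [N HN] := h e e0.
by exists N => // n /= Nn; exact: HN.
Qed.

Lemma cvg_le_dist u v l : (forall n, `|l - u n| <= v n) -> v @ \oo --> (0 : R) ->
  u @ \oo --> l.
Proof.
move=> H /cvg_epsP h; apply/cvg_epsP => e e0; have [N HN] := h e e0.
exists N => n Nn; have := HN n Nn; rewrite sub0r normrN => h1.
by apply: le_trans (H n) _; apply: le_trans (ler_norm _) h1.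
Qed.

Lemma series_le_lim u l n : (forall k, 0 <= u k) -> series u @ \oo --> l ->
  series u n <= l.
Proof.
move=> u0 h; have <- := cvg_lim (@Rhausdorff R) h.
apply: nondecreasing_cvgn_le; last by apply/cvg_ex; exists l.
by move=> m k mk; rewrite /series /= [leRHS](big_cat_nat (leq0n _) mk) //= lerDl sumr_ge0.
Qed.

Lemma series_dominated u v l n g : (forall k, `|u k| <= v k) ->
  series u @ \oo --> l -> series v @ \oo --> g ->
  `|l - series u n| <= g - series v n.
Proof.
move=> uv ul vg; have v0 k : 0 <= v k by apply: le_trans (normr_ge0 _) (uv k).
have h m : (n <= m)%N -> `|series u m - series u n| <= g - series v n.
  move=> nm; rewrite /series /= [X in X - _](big_cat_nat (leq0n _) nm) //= [X in `|X|]addrC addKr.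
  apply: le_trans (ler_norm_sum _ _ _) _.
  apply: (@le_trans _ _ (\sum_(n <= i < m) v i)); first exact: ler_sum.
  have := series_le_lim m v0 vg.
  rewrite /series /= [X in X <= _ -> _](big_cat_nat (leq0n _) nm) //=; lra.
have hc : (fun m => `|series u m - series u n|) @ \oo --> `|l - series u n|.
  by apply: cvg_norm; apply: cvgB => //; exact: cvg_cst.
apply: (ler_cvg_to hc (cvg_cst _)); exists n => // m /= nm; exact: h.
Qed.

(** Both iterated sums are compared with the same rectangle k < M, j < J; the domination bounds the
    two discrepancies by tails of [q] and of [p]. M tends to infinity first, then J. *)
Lemma series_swap (a : nat -> nat -> R) (b h p q : nat -> R) (P Q B : R) :
  (forall k, 0 <= p k) -> (forall j, 0 <= q j) ->
  (forall k j, `|a k j| <= p k * q j) ->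
  series p @ \oo --> P -> series q @ \oo --> Q ->
  (forall k, series (a k) @ \oo --> b k) ->
  (forall j, series (a ^~ j) @ \oo --> h j) ->
  series b @ \oo --> B -> series h @ \oo --> B.
Proof.
move=> p0 q0 apq pP qQ ab ah bB.
have scale (v : nat -> R) c x : series v @ \oo --> x -> series (fun j => c * v j) @ \oo --> c * x.
  move=> vx; have -> : series (fun j => c * v j) = fun n => c * series v n.
    by apply/funext => n; rewrite /series /= mulr_sumr.
  by apply: cvgM vx; exact: cvg_cst.
have hb k J : `|b k - \sum_(0 <= j < J) a k j| <= p k * (Q - series q J).
  have := series_dominated J (apq k) (ab k) (scale _ (p k) _ qQ).
  by rewrite /series /= -mulr_sumr mulrBr.
have hh j M : `|h j - \sum_(0 <= k < M) a k j| <= q j * (P - series p M).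
  have := @series_dominated (a ^~ j) (fun k => q j * p k) (h j) M (q j * P) _ (ah j) (scale _ _ _ pP).
  rewrite /series /= -mulr_sumr -mulrBr; apply => k; by rewrite mulrC.
have key M J : `|series b M - series h J| <= P * (Q - series q J) + Q * (P - series p M).
  have QJ : 0 <= Q - series q J by rewrite subr_ge0; exact: series_le_lim.
  have PM : 0 <= P - series p M by rewrite subr_ge0; exact: series_le_lim.
  have -> : series b M - series h J = \sum_(0 <= k < M) (b k - \sum_(0 <= j < J) a k j) -
      \sum_(0 <= j < J) (h j - \sum_(0 <= k < M) a k j).
    rewrite !sumrB [X in _ = _ - X - _]exchange_big_nat /= /series /=; ring.
  apply: le_trans (ler_normB _ _) _; apply: lerD.
    apply: le_trans (ler_norm_sum _ _ _) _.
    apply: (@le_trans _ _ (series p M * (Q - series q J))).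
      by rewrite /series /= mulr_suml; apply: ler_sum => k _; exact: hb.
    by apply: ler_wpM2r => //; exact: series_le_lim.
  apply: le_trans (ler_norm_sum _ _ _) _.
  apply: (@le_trans _ _ (series q J * (P - series p M))).
    by rewrite [series q J]/series /= mulr_suml; apply: ler_sum => k _; exact: hh.
  by apply: ler_wpM2r => //; exact: series_le_lim.
apply: (@cvg_le_dist _ (fun J => P * (Q - series q J))) => [J|].
  have h1 : (fun M => `|series b M - series h J|) @ \oo --> `|B - series h J|.
    by apply: cvg_norm; apply: cvgB => //; exact: cvg_cst.
  have h2 : (fun M => P * (Q - series q J) + Q * (P - series p M)) @ \oo --> P * (Q - series q J) + Q * (P - P).
    apply: cvgD; first exact: cvg_cst.
    by apply: cvgM; [exact: cvg_cst|apply: cvgB => //; exact: cvg_cst].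
  have := ler_cvg_to h1 h2; rewrite subrr mulr0 addr0; apply.
  by exists 0%N => // M _ /=; exact: key.
have : (fun J => P * (Q - series q J)) @ \oo --> P * (Q - Q).
  by apply: cvgM; [exact: cvg_cst|apply: cvgB => //; exact: cvg_cst].
by rewrite subrr mulr0.
Qed.

(** The terms at a point [v] are bounded by some M, so at [q * v] with q <= 1/2 the terms after the
    first add up to at most 2 M q; small q forces the constant term to vanish. Only u > 0 is assumed
    because [pseries_continuation] controls one side of a point. *)
Lemma pseries_zero_coef0 (d : nat -> R) (r : R) : 0 < r ->
  (forall u : R, 0 < u < r -> series (fun j => d j * u ^+ j) @ \oo --> (0 : R)) ->
  d 0%N = 0.
Proof.
move=> r0 H.
pose v := r / 2; have v0 : 0 < v by rewrite divr_gt0.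
have vr : v < r by rewrite /v; lra.
have /cvg_series_bounded : cvgn (series (fun j => d j * v ^+ j)).
  by apply/cvg_ex; exists 0; apply: H; rewrite v0 vr.
case=> M0 [_ /(_ (`|M0| + 1))].
have -> : M0 < `|M0| + 1 by apply: le_lt_trans (ler_norm _) _; rewrite ltrDl.
move=> /(_ isT); set M := `|M0| + 1 => hM.
have M0' : 0 < M by rewrite /M ltr_wpDl.
have key (q : R) : 0 < q <= 2^-1 -> `|d 0%N| <= 2 * M * q.
  move=> /andP[q0 q1].
  have qv : 0 < q * v < r.
    by rewrite mulr_gt0 //=; apply: le_lt_trans vr; rewrite ler_piMl ?ltW //; lra.
  have h := H _ qv.
  have geo n : \sum_(0 <= j < n) (2^-1 : R) ^+ j <= 2.
    rewrite big_mkord; elim: n {h} => [|n IH]; first by rewrite big_ord0.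
    rewrite big_ord_recl expr0; under eq_bigr do rewrite exprS.
    rewrite -mulr_sumr; lra.
  have hn n : `|d 0%N - series (fun j => d j * (q * v) ^+ j) n.+1| <= 2 * M * q.
    rewrite /series /= big_nat_recl // expr0 mulr1 opprD addrA subrr sub0r normrN.
    apply: le_trans (ler_norm_sum _ _ _) _.
    apply: (@le_trans _ _ (\sum_(0 <= i < n) M * q * 2^-1 ^+ i)).
      apply: ler_sum => i _; rewrite exprMn mulrCA mulrC normrM -mulrA.
      apply: ler_pM => //; first by have := hM i.+1 Logic.I.
      rewrite ger0_norm; last by apply/exprn_ge0/ltW.
      rewrite exprS; apply: ler_wpM2l; first exact: ltW.
      by apply: lerXn2r; rewrite ?nnegrE ?invr_ge0 // ltW.
    rewrite -mulr_sumr [leRHS](_ : _ = M * q * 2); last by ring.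
    by rewrite ler_wpM2l // mulr_ge0 ?ltW.
  have h1 : (fun n => `|d 0%N - series (fun j => d j * (q * v) ^+ j) n.+1|) @ \oo --> `|d 0%N - 0|.
    apply: cvg_norm; apply: cvgB; first exact: cvg_cst.
    by rewrite (cvg_shiftS (series (fun j => d j * (q * v) ^+ j))).
  have := ler_cvg_to h1 (cvg_cst (2 * M * q)); rewrite subr0; apply.
  by exists 0%N.
apply/eqP; rewrite -normr_le0 leNgt; apply/negP => d0.
pose q := Num.min (2^-1) (`|d 0%N| / (4 * M)).
have q0 : 0 < q <= 2^-1.
  by rewrite /q lt_min invr_gt0 ltr0n divr_gt0 ?mulr_gt0 //= ge_min lexx.
have := key q q0.
have : 2 * M * q <= `|d 0%N| / 2.
  apply: (@le_trans _ _ (2 * M * (`|d 0%N| / (4 * M)))).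
    apply: ler_wpM2l; first by apply: mulr_ge0 => //; exact: ltW.
    by rewrite /q ge_min lexx orbT.
  rewrite le_eqVlt; apply/orP; left; apply/eqP; field; lra.
lra.
Qed.

Lemma pseries_zero_coef (d : nat -> R) (r : R) : 0 < r ->
  (forall u : R, 0 < u < r -> series (fun j => d j * u ^+ j) @ \oo --> (0 : R)) ->
  forall j, d j = 0.
Proof.
move=> r0 H j; elim: j d H => [|j IH] d H; first exact: (pseries_zero_coef0 r0).
have d0 := pseries_zero_coef0 r0 H.
apply: (IH (fun i => d i.+1)) => u ur.
have un0 : u != 0 by case/andP: ur => h _; rewrite gt_eqF.
have := H u ur; rewrite -cvg_shiftS => h.
have -> : series (fun i => d i.+1 * u ^+ i) = fun n => u^-1 * series (fun i => d i * u ^+ i) n.+1.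
  apply/funext => n; rewrite /series /= big_nat_recl // d0 mul0r add0r mulr_sumr.
  by apply: eq_bigr => i _; rewrite exprS mulrCA mulKf // mulrC.
by rewrite -(mulr0 u^-1); apply: cvgM => //; exact: cvg_cst.
Qed.

(** A head of fixed length is diluted by 1/N; on the rest [e] is small against weights of bounded
    mean. *)
Lemma mean_weighted_cvg0 (e a : nat -> R) (C : R) :
  (forall n, 0 <= a n) -> (forall N, N%:R^-1 * series a N <= C) ->
  e @ \oo --> (0 : R) ->
  (fun N => N%:R^-1 * series (fun n => e n * a n) N) @ \oo --> (0 : R).
Proof.
move=> a0 aC /cvg_epsP he.
have C0 : 0 <= C by have := aC 0%N; rewrite /series /= big_geq // mulr0.
apply/cvg_epsP => d d0.
pose d' := d / (2 * (C + 1)).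
have d'0 : 0 < d' by rewrite divr_gt0 // mulr_gt0 //; lra.
have [n0 Hn0] := he _ d'0.
pose S0 := \sum_(0 <= n < n0) `|e n * a n|.
have S00 : 0 <= S0 by apply: sumr_ge0.
have [N1 HN1] : exists N1 : nat, 2 * S0 / d <= N1%:R.
  by exists (Num.truncn (2 * S0 / d)).+1; apply/ltW/truncnS_gt.
exists (maxn N1 n0).+1 => N; rewrite gtn_max => /andP[N1N n0N].
have Np : (0 : R) < N%:R by rewrite ltr0n (leq_ltn_trans _ N1N).
rewrite sub0r normrN normrM ger0_norm ?invr_ge0 ?ler0n //.
rewrite /series /= (big_cat_nat (leq0n _) (ltnW n0N)) //=.
have h1 : `|\sum_(0 <= n < n0) e n * a n + \sum_(n0 <= n < N) e n * a n| <= S0 + d' * series a N.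
  apply: le_trans (ler_normD _ _) _; apply: lerD; first exact: ler_norm_sum.
  apply: le_trans (ler_norm_sum _ _ _) _.
  apply: (@le_trans _ _ (\sum_(n0 <= n < N) d' * a n)).
    apply: ler_sum_nat => n /andP[nn _]; rewrite normrM (ger0_norm (a0 n)) ler_wpM2r //.
    by have := Hn0 n nn; rewrite sub0r normrN.
  rewrite -mulr_sumr; apply: ler_wpM2l; first exact: ltW.
  rewrite /series /= [leRHS](big_cat_nat (leq0n _) (ltnW n0N)) //=.
  by rewrite lerDr sumr_ge0.
apply: le_trans (ler_wpM2l _ h1) _; first by rewrite invr_ge0 ltW.
rewrite mulrDr mulrCA.
have h2 : N%:R^-1 * S0 <= d / 2.
  rewrite ler_pdivrMl // -ler_pdivrMr ?divr_gt0 //.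
  have -> : S0 / (d / 2) = 2 * S0 / d by field; lra.
  by apply: le_trans HN1 _; rewrite ler_nat ltnW.
have h3 : d' * (N%:R^-1 * series a N) <= d / 2.
  apply: (@le_trans _ _ (d' * (C + 1))).
    by rewrite ler_wpM2l ?ltW //; have := aC N; lra.
  rewrite le_eqVlt; apply/orP; left; apply/eqP; rewrite /d'; field; lra.
lra.
Qed.

Lemma mean_cvg_bounded (a : nat -> R) l :
  (fun N => N%:R^-1 * series a N) @ \oo --> l ->
  exists C, forall N, N%:R^-1 * series a N <= C.
Proof.
move=> h; have /cvg_seq_bounded : cvgn (fun N => N%:R^-1 * series a N) by apply/cvg_ex; exists l.
case=> M [_ /(_ (`|M| + 1))].
have -> : M < `|M| + 1 by apply: le_lt_trans (ler_norm _) _; rewrite ltrDl.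
move=> /(_ isT) hM; exists (`|M| + 1) => N.
by apply: le_trans (ler_norm _) _; have := hM N Logic.I.
Qed.

Lemma mean_cst_le (a : R) N : 0 <= a -> N%:R^-1 * series (fun=> a) N <= a.
Proof.
move=> a0; rewrite /series /=; rewrite sumr_const_nat subn0 -[a *+ _]mulr_natl mulrA.
case: N => [|N]; first by rewrite mulr0 mul0r.
by rewrite mulVf ?mul1r // pnatr_eq0.
Qed.

Lemma mean_cvg (u : nat -> R) l : u @ \oo --> l ->
  (fun N => N%:R^-1 * series u N) @ \oo --> l.
Proof.
move=> ul; rewrite -cvg_shiftS.
have := cesaro ul; rewrite /arithmetic_mean /=.
by apply: cvg_trans; apply: near_eq_cvg; near=> n; rewrite /= (mulrC _^-1).
Unshelve. all: by end_near.
Qed.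

(** As u may be unbounded, [v n ^+ 2 - u n ^+ 2] need not tend to 0. Divided by [1 + u n ^+ 2] it
    does, and these weights have bounded means because the means of the squares of u converge. *)
Lemma mean_sqr_perturb (u v : nat -> R) l :
  (forall n, 0 <= u n) -> (fun n => v n - u n) @ \oo --> (0 : R) ->
  (fun N => N%:R^-1 * series (fun n => u n ^+ 2) N) @ \oo --> l ->
  (fun N => N%:R^-1 * series (fun n => v n ^+ 2) N) @ \oo --> l.
Proof.
move=> u0 uv ul.
have [C HC] := mean_cvg_bounded ul.
pose a n := 1 + u n ^+ 2.
pose e n := (v n ^+ 2 - u n ^+ 2) / a n.
have a1 n : 1 <= a n by rewrite lerDl sqr_ge0.
have e0 : e @ \oo --> (0 : R).
  pose dd n : R := `|v n - u n|.
  have dd0 : dd @ \oo --> (0 : R) by rewrite -[X in _ --> X](@normr0 _ R); exact: cvg_norm.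
  apply: (@cvg_le_dist _ (fun n => dd n * dd n + 2 * dd n)) => [n|]; last first.
    rewrite -[X in _ --> X](_ : 0 * 0 + 2 * 0 = 0); last by rewrite !mulr0 addr0.
    by apply: cvgD; apply: cvgM => //; exact: cvg_cst.
  rewrite sub0r normrN /e normrM normfV (ger0_norm (le_trans ler01 (a1 n))).
  rewrite ler_pdivrMr ?(lt_le_trans ltr01 (a1 n)) //.
  have -> : v n ^+ 2 - u n ^+ 2 = (v n - u n) * (v n - u n) + 2 * (v n - u n) * u n by ring.
  apply: le_trans (ler_normD _ _) _.
  rewrite !normrM (ger0_norm (u0 n)) (ger0_norm (ler0n _ 2)) -/(dd n).
  have d0 : 0 <= dd n by exact: normr_ge0.
  have ua : u n <= a n by rewrite /a; have := sqr_ge0 (u n - 1); have := u0 n; nra.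
  rewrite [leRHS]mulrDl; apply: lerD; last by rewrite ler_wpM2l // mulr_ge0.
  by rewrite ler_peMr // mulr_ge0.
have h : (fun N => N%:R^-1 * series (fun n => e n * a n) N) @ \oo --> (0 : R).
  apply: (@mean_weighted_cvg0 _ _ (1 + C)) => // [n|N]; first exact: le_trans ler01 (a1 n).
  have -> : series a N = series (fun=> 1) N + series (fun n => u n ^+ 2) N.
    by rewrite /series /= -big_split.
  by rewrite mulrDr; apply: lerD => //; exact: mean_cst_le.
have -> : (fun N => N%:R^-1 * series (fun n => v n ^+ 2) N) =
   (fun N => N%:R^-1 * series (fun n => u n ^+ 2) N + N%:R^-1 * series (fun n => e n * a n) N).
  apply/funext => N; rewrite -mulrDr; congr (_ * _); rewrite /series /= -big_split /=.
  apply: eq_bigr => n _; rewrite /e divfK ?gt_eqF ?(lt_le_trans ltr01 (a1 n)) //; ring.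
by rewrite -[X in _ --> X]addr0; apply: cvgD.
Qed.

(* Between consecutive fourth powers the mean changes by
   a factor tending to 1, since the partial sums are monotone. *)
Lemma mean_cvg_fourth_powers (X : nat -> R) l : (forall n, 0 <= X n) ->
  (fun j => (j.+1 ^ 4)%N%:R^-1 * series X (j.+1 ^ 4)%N) @ \oo --> l ->
  (fun N => N%:R^-1 * series X N) @ \oo --> l.
Proof.
move=> X0 h.
pose r j := (j.+1 ^ 4)%N%:R^-1 * series X (j.+1 ^ 4)%N.
pose g j : R := (1 + j.+1%:R^-1) ^+ 4.
have g1 : g @ \oo --> (1 : R).
  have g' : (fun j => 1 + j.+1%:R^-1 : R) @ \oo --> (1 : R).
    by rewrite -[X in _ --> X]addr0; apply: cvgD; [exact: cvg_cst|exact: cvg_harmonic].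
  rewrite -[X in _ --> X](_ : 1 * (1 * (1 * 1)) = 1); last by rewrite !mulr1.
  by do !apply: cvgM.
have g0 j : 0 < g j by rewrite exprn_gt0 // ltr_pwDl.
have gE j : (j.+2 ^ 4)%N%:R = (j.+1 ^ 4)%N%:R * g j :> R.
  rewrite !natrX -exprMn; congr (_ ^+ 4); rewrite mulrDr mulr1 divff ?pnatr_eq0 //.
  by rewrite natr1.
(* [r j.+1 * g j] is the sum up to (j + 2)^4 divided by (j + 1)^4, and [r j / g j] the sum up to (j
   + 1)^4 divided by (j + 2)^4: they enclose every mean in between. *)
have up : (fun j => r j.+1 * g j) @ \oo --> l.
  by rewrite -[X in _ --> X]mulr1; apply: cvgM => //; rewrite (cvg_shiftS r).
have lo : (fun j => r j * (g j)^-1) @ \oo --> l.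
  rewrite -[X in _ --> X]mulr1 -{1}invr1; apply: cvgM => //.
  by apply: cvgV => //; exact: oner_neq0.
apply/cvg_epsP => e e0.
move/cvg_epsP: up => /(_ e e0) [J1 HJ1]; move/cvg_epsP: lo => /(_ e e0) [J2 HJ2].
exists ((maxn J1 J2).+1 ^ 4)%N => N NJ.
have [j jN Nj] : exists2 j, ((j.+1 ^ 4 <= N)%N) & ((N < j.+2 ^ 4)%N).
  have e1 : exists j, (j.+1 ^ 4 <= N)%N by exists (maxn J1 J2).
  have b1 j : (j.+1 ^ 4 <= N)%N -> (j <= N)%N.
    move=> hj; apply: leq_trans hj; apply: leq_trans (leqnSn j) _.
    exact: (@leq_pexp2l j.+1 1 4).
  have := ex_maxnP e1 b1; case=> j hj hm; exists j => //.
  by rewrite ltnNge; apply/negP => hj'; have := hm _ hj'; rewrite ltnn.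
have jJ : (maxn J1 J2 <= j)%N.
  have : ((maxn J1 J2).+1 ^ 4 < j.+2 ^ 4)%N by exact: leq_ltn_trans NJ Nj.
  by rewrite ltn_exp2r.
rewrite geq_max in jJ; case/andP: jJ => /HJ1 h1 /HJ2 h2.
have mono m k : (m <= k)%N -> series X m <= series X k.
  by move=> mk; rewrite /series /= [leRHS](big_cat_nat (leq0n _) mk) //= lerDl sumr_ge0.
have S0 m : 0 <= series X m by rewrite /series /= sumr_ge0.
have N0 : (0 : R) < N%:R by rewrite ltr0n (leq_trans _ jN) // expn_gt0.
have p4 i : (0 : R) < (i.+1 ^ 4)%N%:R by rewrite ltr0n expn_gt0.
have hu : N%:R^-1 * series X N <= r j.+1 * g j.
  have -> : r j.+1 * g j = (j.+1 ^ 4)%N%:R^-1 * series X (j.+2 ^ 4)%N.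
    by rewrite /r gE; field; rewrite !gt_eqF.
  apply: ler_pM; rewrite ?invr_ge0 ?ler0n //; last exact/mono/ltnW.
  by rewrite lef_pV2 ?posrE // ler_nat.
have hl : r j * (g j)^-1 <= N%:R^-1 * series X N.
  rewrite /r mulrAC -invfM -gE.
  apply: ler_pM; rewrite ?invr_ge0 ?ler0n //; last exact: mono.
  by rewrite lef_pV2 ?posrE // ler_nat ltnW.
move: h1 h2; rewrite !ler_norml => /andP[a1 a2] /andP[b1 b2]; apply/andP; split; lra.
Qed.

End sequences.

(** * Oscillatory sums and integrals *)

Section resonance.
Variable R : realType.
Implicit Types (A B C c u x : R) (N K : nat).

Definition harm N : R := \sum_(i < N) i.+1%:R^-1.

Lemma harm_ge0 N : 0 <= harm N.
Proof. by apply: sumr_ge0 => i _; rewrite invr_ge0. Qed.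

Lemma harm_le N K : (N <= K)%N -> harm N <= harm K.
Proof.
move=> NK; rewrite /harm -(subnKC NK) big_split_ord /= lerDl.
by apply: sumr_ge0 => i _; rewrite invr_ge0.
Qed.

Lemma harm_ge1 N : (0 < N)%N -> 1 <= harm N.
Proof.
by move=> N0; apply: le_trans (harm_le N0); rewrite /harm big_ord1 invr1.
Qed.

(* The term m = i is 0, since 0^-1 = 0. *)
Lemma sum_inv_dist N i : (i < N)%N ->
  \sum_(m < N) `|m%:R - i%:R : R|^-1 <= 2 * harm N.
Proof.
move=> iN; rewrite -(big_mkord xpredT (fun m => `|m%:R - i%:R : R|^-1)).
rewrite (@big_cat_nat _ _ _ i) //=; last exact: ltnW.
rewrite mulrDl mul1r; apply: lerD.
  rewrite big_nat_rev add0n.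
  apply: le_trans (harm_le (ltnW iN)).
  rewrite /harm big_mkord; apply: ler_sum => j _.
  by rewrite distrC -natrB ?leq_subr // subKn // normr_nat.
rewrite big_ltn // subrr normr0 invr0 add0r.
rewrite -{1}[i.+1]add0n big_addn big_mkord.
apply: (@le_trans _ _ (harm (N - i.+1))); last exact/harm_le/leq_subr.
apply: ler_sum => j _.
by rewrite -natrB ?leq_addr ?(leq_trans _ (leq_addl _ _)) // addnS subSn ?leq_addl// addnK normr_nat.
Qed.

(** Bound for the integral of cos (c + x u) over [0, A], see [osc_int_cos]. The case u = 0 is
    separate because 2 / 0 is 0 by convention and would make the minimum 0. *)
Definition osc_bound A u : R := if u == 0 then A else Num.min A (2 / `|u|).

Lemma osc_bound_le A u : osc_bound A u <= A.
Proof. by rewrite /osc_bound; case: ifP => // _; rewrite ge_min lexx. Qed.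

Lemma osc_bound_inv A u : u != 0 -> osc_bound A u <= 2 / `|u|.
Proof. by rewrite /osc_bound => /negbTE->; rewrite ge_min lexx orbT. Qed.

(* Away from the term of smallest frequency, the m-th frequency is at least
   half its distance to the smallest one. *)
Lemma sum_osc_bound A c u N : 0 <= A -> u != 0 ->
  \sum_(m < N) osc_bound A (c + m%:R * u) <= A + 8 * harm N / `|u|.
Proof.
move=> A0 u0; case: N => [|N].
  by rewrite big_ord0 /harm big_ord0 mulr0 mul0r addr0.
have [m0 _ hmin] := arg_minP (fun m : 'I_N.+1 => `|c + m%:R * u|) (erefl : xpredT (ord0 : 'I_N.+1)).
rewrite (bigD1 m0) //=; apply: lerD; first exact: osc_bound_le.
apply: (@le_trans _ _ (\sum_(m < N.+1 | m != m0) 4 / `|u| * `|m%:R - m0%:R : R|^-1)).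
  apply: ler_sum => m mm0.
  have dm : (m%:R - m0%:R : R) != 0.
    by rewrite subr_eq0 eqr_nat; apply: contra mm0 => /eqP h; apply/eqP/val_inj.
  have h : `|m%:R - m0%:R : R| * `|u| <= 2 * `|c + m%:R * u|.
    rewrite -normrM mulrBl.
    have -> : m%:R * u - m0%:R * u = (c + m%:R * u) - (c + m0%:R * u) by ring.
    apply: le_trans (ler_normB _ _) _.
    have := hmin m isT; lra.
  have p : 0 < `|m%:R - m0%:R : R| * `|u| by rewrite mulr_gt0 // normr_gt0.
  have q : 0 < `|c + m%:R * u| by lra.
  apply: le_trans (osc_bound_inv _ _) _; first by rewrite -normr_gt0.
  rewrite -mulrA -invfM (mulrC `|u|) ler_pdivrMr // mulrC.
  rewrite (mulrC `|u|) mulrAC.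
  rewrite ler_pdivlMr //; lra.
rewrite -mulr_sumr.
have -> : 8 * harm N.+1 / `|u| = 4 / `|u| * (2 * harm N.+1) by ring.
apply: ler_wpM2l; first by rewrite divr_ge0.
apply: le_trans (sum_inv_dist (ltn_ord m0)).
by rewrite [leRHS](bigD1 m0) //= lerDr invr_ge0.
Qed.

(** * Logarithmic frequencies and sums of pair weights *)

Definition log_ratio (p : nat * nat) : R := ln p.1.+1%:R - ln p.2.+1%:R.

Lemma log_ratio_neq0 (p : nat * nat) : p.1 != p.2 -> log_ratio p != 0.
Proof.
apply: contra; rewrite /log_ratio subr_eq0 => /eqP /ln_inj h.
by have := h (ltr0Sn _ _) (ltr0Sn _ _) => /eqP; rewrite eqr_nat eqSS.
Qed.

Lemma ln_sub_ge (x y : R) : 0 < x -> x <= y -> (y - x) / y <= ln y - ln x.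
Proof.
move=> x0 xy; have y0 := lt_le_trans x0 xy.
have h : ln (x / y) <= x / y - 1.
  have := @le_ln1Dx R (x / y - 1).
  have -> : 1 + (x / y - 1) = x / y by ring.
  apply; have : 0 < x / y by rewrite divr_gt0.
  lra.
rewrite ln_div ?posrE // in h.
have -> : (y - x) / y = 1 - x / y by field; lra.
lra.
Qed.

(** By [ln_sub_ge] the logarithm is at least |k - l| over the larger of k + 1 and l + 1. The sum
    replaces the maximum because, divided by (k + 1) (l + 1), it splits into 1 / (k + 1) + 1 / (l +
    1). For k = l both sides are 0. *)
Lemma log_ratio_inv_le (k l : nat) :
  `|log_ratio (k, l)|^-1 <= (k.+1%:R + l.+1%:R) * `|k%:R - l%:R : R|^-1.
Proof.
have [->|kl] := eqVneq k l.
  by rewrite /log_ratio /= !subrr normr0 invr0 mulr0.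
wlog lk : k l kl / (l < k)%N.
  move=> H; have [lk|lk|/eqP e] := ltngtP l k; first exact: H.
    have := H l k; rewrite eq_sym => /(_ kl lk).
    by rewrite /log_ratio /= (distrC l%:R) (distrC (ln l.+1%:R)) (addrC l.+1%:R).
  by rewrite eq_sym e in kl.
have a0 : (0 : R) < k%:R - l%:R by rewrite subr_gt0 ltr_nat.
have b0 : (0 : R) < k.+1%:R by [].
have h : (k%:R - l%:R) / k.+1%:R <= log_ratio (k, l).
  have -> : (k%:R - l%:R : R) = k.+1%:R - l.+1%:R by rewrite -!natr1; ring.
  by apply: ln_sub_ge; rewrite // ler_nat ltnW.
have h0 : 0 < (k%:R - l%:R : R) / k.+1%:R by rewrite divr_gt0.
have h1 : 0 < log_ratio (k, l) by exact: lt_le_trans h0 h.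
rewrite !gtr0_norm // -[leLHS]mul1r ler_pdivrMr //.
apply: (@le_trans _ _ ((k.+1%:R + l.+1%:R) / (k%:R - l%:R) * ((k%:R - l%:R) / k.+1%:R))).
  rewrite mulrA divfK ?gt_eqF // ler_pdivlMr // mul1r lerDl //.
by rewrite ler_wpM2l // divr_ge0 // ltW // addr_gt0.
Qed.

Section weights.
Variables (K : nat) (w : nat -> R) (kappa : R).
Hypothesis w_ge0 : forall k, 0 <= w k.
Hypothesis w_le : forall k, (k < K)%N -> w k <= kappa / k.+1%:R.

Let pair_weight (p : 'I_K * 'I_K) : R := w p.1 * w p.2.

Lemma sum_pair_weight : 0 <= kappa -> \sum_p pair_weight p <= (kappa * harm K) ^+ 2.
Proof.
move=> k0.
have h : \sum_(k < K) w k <= kappa * harm K.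
  by rewrite /harm mulr_sumr; apply: ler_sum => k _; exact: w_le.
have -> : \sum_p pair_weight p = (\sum_(k < K) w k) ^+ 2.
  rewrite expr2 big_distrlr /= pair_big /=.
  by apply: eq_bigr => -[].
by rewrite lerXn2r // nnegrE ?mulr_ge0 ?harm_ge0 // sumr_ge0.
Qed.

(** Each of the two terms left by [log_ratio_inv_le] is summed first over the index that occurs only
    in |k - l|, where [sum_inv_dist] applies. *)
Lemma sum_pair_weight_log : 0 <= kappa ->
  \sum_p pair_weight p / `|log_ratio (p.1 : nat, p.2 : nat)| <= 4 * (kappa * harm K) ^+ 2.
Proof.
move=> k0.
apply: (@le_trans _ _ (\sum_(p : 'I_K * 'I_K) kappa ^+ 2 * (p.1.+1%:R^-1 + p.2.+1%:R^-1) * `|p.1%:R - p.2%:R : R|^-1)).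
  apply: ler_sum => -[k l] _ /=.
  have kp : (0 : R) < k.+1%:R by [].
  have lp : (0 : R) < l.+1%:R by [].
  apply: (@le_trans _ _ ((kappa / k.+1%:R) * (kappa / l.+1%:R) * ((k.+1%:R + l.+1%:R) * `|k%:R - l%:R : R|^-1))).
    apply: ler_pM; rewrite ?mulr_ge0 ?invr_ge0 //; last exact: log_ratio_inv_le.
    by apply: ler_pM => //; apply: w_le.
  rewrite mulrA le_eqVlt; apply/orP; left; apply/eqP.
  rewrite [LHS]mulrA; congr (_ * _); move: (k.+1%:R) (l.+1%:R) kp lp => a b a0 b0.
  by field; rewrite !lt0r_neq0.
have -> : 4 * (kappa * harm K) ^+ 2 = kappa ^+ 2 * (harm K * (2 * harm K)) + kappa ^+ 2 * (harm K * (2 * harm K)).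
  by ring.
have E : \sum_(p : 'I_K * 'I_K) kappa ^+ 2 * (p.1.+1%:R^-1 + p.2.+1%:R^-1) * `|p.1%:R - p.2%:R : R|^-1 =
   kappa ^+ 2 * (\sum_(k < K) k.+1%:R^-1 * (\sum_(l < K) `|l%:R - k%:R : R|^-1)) +
   kappa ^+ 2 * (\sum_(l < K) l.+1%:R^-1 * (\sum_(k < K) `|k%:R - l%:R : R|^-1)).
  under eq_bigr do rewrite mulrDr mulrDl.
  rewrite big_split /=; congr (_ + _).
    rewrite -(pair_bigA _ (fun k l : 'I_K => kappa ^+ 2 * k.+1%:R^-1 * `|k%:R - l%:R : R|^-1)) /=.
    rewrite mulr_sumr; apply: eq_bigr => k _; rewrite mulrA mulr_sumr.
    by apply: eq_bigr => l _; rewrite distrC.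
  rewrite -(pair_bigA _ (fun k l : 'I_K => kappa ^+ 2 * l.+1%:R^-1 * `|k%:R - l%:R : R|^-1)) /=.
  rewrite exchange_big /= mulr_sumr; apply: eq_bigr => k _; rewrite mulrA mulr_sumr.
  by apply: eq_bigr => l _.
have H : \sum_(k < K) k.+1%:R^-1 * (\sum_(l < K) `|l%:R - k%:R : R|^-1) <= harm K * (2 * harm K).
  rewrite {1}/harm mulr_suml; apply: ler_sum => k _.
  by rewrite ler_wpM2l ?invr_ge0 // sum_inv_dist.
by rewrite E; apply: lerD; apply: ler_wpM2l; rewrite ?sqr_ge0.
Qed.

End weights.

(* [osc_int A f B] says that the integral of f over [0, A] is at most B in
   absolute value, witnessed by an antiderivative. *)
Definition osc_int A (f : R -> R) B :=
  exists F : R -> R, (forall x, is_derive x 1 F (f x)) /\ `|F A - F 0| <= B.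

Lemma osc_intW A f B C : B <= C -> osc_int A f B -> osc_int A f C.
Proof. by move=> BC [F [dF FB]]; exists F; split => //; apply: le_trans FB BC. Qed.

Lemma osc_int_ext A f g B : f =1 g -> osc_int A f B -> osc_int A g B.
Proof. by move=> /funext ->. Qed.

Lemma osc_intZ A c f B : osc_int A f B -> osc_int A (fun x => c * f x) (`|c| * B).
Proof.
move=> [F [dF FB]]; exists (fun x => c * F x); split => [x|].
  have d := dF x; apply: is_derive_eq; rewrite /GRing.scale /=; ring.
by rewrite -mulrBr normrM ler_wpM2l.
Qed.

Lemma osc_intD A f g B C : osc_int A f B -> osc_int A g C ->
  osc_int A (fun x => f x + g x) (B + C).
Proof.
move=> [F [dF FB]] [G [dG GC]]; exists (fun x => F x + G x); split => [x|].
  have d := dF x; have d' := dG x; exact: is_deriveD.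
have -> : F A + G A - (F 0 + G 0) = (F A - F 0) + (G A - G 0) by ring.
by apply: le_trans (ler_normD _ _) _; apply: lerD.
Qed.

Lemma osc_int_sum A (I : Type) (s : seq I) (P : pred I) f (B : I -> R) :
  (forall i, P i -> osc_int A (f i) (B i)) ->
  osc_int A (fun x => \sum_(i <- s | P i) f i x) (\sum_(i <- s | P i) B i).
Proof.
move=> H; elim: s => [|i s IH].
  rewrite big_nil; apply: (@osc_int_ext _ (fun=> 0)) => [x|]; first by rewrite big_nil.
  by exists (fun=> 0); split => [x|]; [exact: is_derive_cst|rewrite subrr normr0].
apply: (@osc_int_ext _ (fun x => (if P i then f i x else 0) + \sum_(i <- s | P i) f i x)) => [x|].
  by rewrite big_cons; case: ifP => // _; rewrite add0r.
rewrite big_cons; case: ifP => [Pi|_].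
  by apply: osc_intD => //; exact: H.
apply: osc_int_ext IH => x; by rewrite add0r.
Qed.

Lemma osc_int_cos A c u : 0 <= A -> osc_int A (fun x => cos (c + x * u)) (osc_bound A u).
Proof.
move=> A0; have [->|u0] := eqVneq u 0.
  rewrite /osc_bound eqxx; exists (fun x => x * cos c); split => [x|].
    apply: is_derive_eq; rewrite mulr0 addr0 /GRing.scale /=; ring.
  rewrite mul0r subr0 normrM ger0_norm // ler_piMr //.
  by rewrite ler_norml cos_geN1 cos_le1.
(* This antiderivative serves both bounds: the mean value theorem gives A, and |sin| <= 1 gives 2 /
   |u|. *)
exists (fun x => u^-1 * sin (c + x * u)); split => [x|].
  apply: is_derive_eq; rewrite /GRing.scale /=; field; exact: u0.
rewrite -mulrBr normrM normfV /osc_bound (negbTE u0) le_min; apply/andP; split.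
  rewrite ler_pdivrMl ?normr_gt0 //.
  have [->|An0] := eqVneq A 0; first by rewrite subrr normr0 mulr0.
  have Ap : 0 < A by rewrite lt_neqAle eq_sym An0.
  have := @MVT R (fun x => sin (c + x * u)) (fun x => cos (c + x * u) * u) 0 A Ap.
  case.
  - move=> x _; apply: is_derive_eq; rewrite /GRing.scale /=; ring.
  - apply: derivable_within_continuous => x _; exact: ex_derive.
  move=> z _ ->; rewrite subr0 !normrM (ger0_norm A0) (mulrC `|u|) mulrAC -mulrA.
  by apply: ler_piMl; rewrite ?mulr_ge0 // ler_norml cos_geN1 cos_le1.
rewrite mulrC ler_wpM2r ?invr_ge0 //.
apply: le_trans (ler_normB _ _) _.
have h y : `|sin y : R| <= 1 by rewrite ler_norml sin_geN1 sin_le1.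
by rewrite -[2]/(1 + 1) lerD.
Qed.

Lemma osc_int_cosM A c u c' u' : 0 <= A ->
  osc_int A (fun x => cos (c + x * u) * cos (c' + x * u'))
    (2^-1 * osc_bound A (u + u') + 2^-1 * osc_bound A (u - u')).
Proof.
move=> A0.
have n2 : `|2^-1| = 2^-1 :> R by rewrite ger0_norm // invr_ge0.
apply: (@osc_int_ext _ (fun x => 2^-1 * cos ((c + c') + x * (u + u')) + 2^-1 * cos ((c - c') + x * (u - u')))) => [x|].
  have -> : c + c' + x * (u + u') = (c + x * u) + (c' + x * u') by ring.
  have -> : c - c' + x * (u - u') = (c + x * u) - (c' + x * u') by ring.
  rewrite cosD cosB; lra.
apply: osc_intD.
  by rewrite -[X in X * osc_bound _ _]n2; apply: osc_intZ; exact: osc_int_cos.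
by rewrite -[X in X * osc_bound _ _]n2; apply: osc_intZ; exact: osc_int_cos.
Qed.

(** The square is expanded over quadruples (n, i, m, j), and [sum_osc_bound] handles the sum over m
    with the other indices fixed. The coefficients [vn] vary with n because the Dirichlet
    polynomials do not all have the same length; they enter through the majorant [v]. *)
Lemma osc_int_sqr A N (I : finType) (P : pred I) (v th : I -> R)
    (vn al : nat -> I -> R) : 0 <= A ->
  (forall i, P i -> th i != 0) ->
  (forall n i, (n < N)%N -> 0 <= vn n i <= v i) ->
  osc_int A (fun x => (\sum_(n < N) \sum_(i | P i) vn n i *
      cos (al n i + x * (n.+1%:R * th i))) ^+ 2)
    (N%:R * (\sum_i v i) * (A * (\sum_i v i) + 8 * harm N * \sum_i v i / `|th i|)).
Proof.
move=> A0 th0 vnP.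
have v0 n i : (n < N)%N -> 0 <= v i by move=> h; have /andP[a b] := vnP n i h; exact: le_trans a b.
pose f n i x := cos (al n i + x * (n.+1%:R * th i)).
apply: (@osc_int_ext _ (fun x => \sum_(n < N) \sum_(i | P i) \sum_(m < N) \sum_(j | P j)
   (vn n i * vn m j) * (f n i x * f m j x))) => [x|].
  rewrite expr2 mulr_suml; apply: eq_bigr => n _.
  rewrite mulr_suml; apply: eq_bigr => i _.
  rewrite mulr_sumr; apply: eq_bigr => m _.
  by rewrite mulr_sumr; apply: eq_bigr => j _; rewrite /f; ring.
have key (n : 'I_N) i j : P i -> P j ->
   \sum_(m < N) (2^-1 * osc_bound A (n.+1%:R * th i + m.+1%:R * th j) +
      2^-1 * osc_bound A (n.+1%:R * th i - m.+1%:R * th j)) <= A + 8 * harm N / `|th j|.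
  move=> Pi Pj; rewrite big_split /= -!mulr_sumr.
  have h1 := sum_osc_bound (n.+1%:R * th i + th j) N A0 (th0 _ Pj).
  have thN : - th j != 0 by rewrite oppr_eq0 th0.
  have h2 := sum_osc_bound (n.+1%:R * th i - th j) N A0 thN.
  rewrite normrN in h2.
  have -> : \sum_(m < N) osc_bound A (n.+1%:R * th i + m.+1%:R * th j) =
      \sum_(m < N) osc_bound A (n.+1%:R * th i + th j + m%:R * th j).
    by apply: eq_bigr => m _; congr osc_bound; rewrite -[m.+1%:R]natr1; ring.
  have -> : \sum_(m < N) osc_bound A (n.+1%:R * th i - m.+1%:R * th j) =
      \sum_(m < N) osc_bound A (n.+1%:R * th i - th j + m%:R * - th j).
    by apply: eq_bigr => m _; congr osc_bound; rewrite -[m.+1%:R]natr1; ring.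
  lra.
apply: (@osc_intW _ _ (\sum_(n < N) \sum_(i | P i) \sum_(m < N) \sum_(j | P j)
   (v i * v j) * (2^-1 * osc_bound A (n.+1%:R * th i + m.+1%:R * th j) +
      2^-1 * osc_bound A (n.+1%:R * th i - m.+1%:R * th j)))); last first.
  apply: osc_int_sum => n _; apply: osc_int_sum => i _.
  apply: osc_int_sum => m _; apply: osc_int_sum => j _.
  have /andP[a1 a2] := vnP n i (ltn_ord n).
  have /andP[b1 b2] := vnP m j (ltn_ord m).
  have b0 u : 0 <= osc_bound A u.
    by rewrite /osc_bound; case: ifP => // _; rewrite le_min A0 divr_ge0.
  apply: (@osc_intW _ _ (`|vn n i * vn m j| * (2^-1 * osc_bound A (n.+1%:R * th i + m.+1%:R * th j) +
      2^-1 * osc_bound A (n.+1%:R * th i - m.+1%:R * th j)))).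
    rewrite ger0_norm ?mulr_ge0 // ler_wpM2r //; first by rewrite addr_ge0 // mulr_ge0.
    by apply: ler_pM.
  by apply: osc_intZ; exact: osc_int_cosM.
apply: (@le_trans _ _ (\sum_(n < N) \sum_(i | P i) \sum_(j | P j) v i * v j * (A + 8 * harm N / `|th j|))).
  apply: ler_sum => n _; apply: ler_sum => i Pi.
  rewrite exchange_big /=; apply: ler_sum => j Pj.
  rewrite -mulr_sumr; apply: ler_wpM2l; last exact: key.
  by rewrite mulr_ge0 // (v0 n).
have -> : N%:R * (\sum_i v i) * (A * (\sum_i v i) + 8 * harm N * \sum_i v i / `|th i|) =
   \sum_(n < N) \sum_i \sum_j v i * v j * (A + 8 * harm N / `|th j|).
  rewrite sumr_const card_ord -mulrA mulr_natl; congr (_ *+ _).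
  rewrite mulr_suml; apply: eq_bigr => i _.
  rewrite !mulr_sumr -big_split /= mulr_sumr; apply: eq_bigr => j _; ring.
apply: ler_sum => n _.
have t0 i j : 0 <= v i * v j * (A + 8 * harm N / `|th j|).
  by rewrite mulr_ge0 ?mulr_ge0 ?addr_ge0 ?(v0 n) // divr_ge0 ?mulr_ge0 ?harm_ge0.
apply: (@le_trans _ _ (\sum_(i | P i) \sum_j v i * v j * (A + 8 * harm N / `|th j|))).
  apply: ler_sum => i _; rewrite [leRHS](bigID P) /= lerDl sumr_ge0 //.
by rewrite [leRHS](bigID P) /= lerDl sumr_ge0 // => i _; rewrite sumr_ge0.
Qed.

End resonance.

(** * Analytic continuation on a horizontal line *)

Section local_power_series.
Variable R : realType.
Implicit Types (f g A B : R -> R) (x u : R).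

Definition local_pseries f x := exists (c : nat -> R) (r : R), 0 < r /\
  forall u, `|u| < r -> series (fun j => c j * u ^+ j) @ \oo --> f (x + u).

Lemma local_pseriesD f g x : local_pseries f x -> local_pseries g x ->
  local_pseries (fun s => f s + g s) x.
Proof.
move=> [c [r [r0 H]]] [d [t [t0 K]]].
exists (fun j => c j + d j), (Num.min r t); split; first by rewrite lt_min r0.
move=> u; rewrite lt_min => /andP[ur ut].
have -> : series (fun j => (c j + d j) * u ^+ j) =
    (fun n => series (fun j => c j * u ^+ j) n + series (fun j => d j * u ^+ j) n).
  by apply/funext => n; rewrite /series /= -big_split /=; apply: eq_bigr => j _; rewrite mulrDl.
by apply: cvgD; [exact: H|exact: K].
Qed.

Lemma local_pseries_cst (a x : R) : local_pseries (fun=> a) x.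
Proof.
exists (fun j => if j is 0%N then a else 0), 1; split => // u _.
rewrite -cvg_shiftS; apply: cvg_near_cst; near=> n.
rewrite /series /= big_nat_recl // big1 ?addr0 ?mulr1 //.
by move=> i _; rewrite mul0r.
Unshelve. all: by end_near.
Qed.

Lemma local_pseries_affine f (a b x : R) : local_pseries f x ->
  local_pseries (fun s => (a + b * s) * f s) x.
Proof.
move=> [c [r [r0 H]]].
exists (fun j => (a + b * x) * c j + b * (if j is i.+1 then c i else 0)), r; split => // u ur.
have h := H u ur.
have -> : (a + b * (x + u)) * f (x + u) = (a + b * x) * f (x + u) + b * u * f (x + u) by ring.
have -> : series (fun j => ((a + b * x) * c j + b * (if j is i.+1 then c i else 0)) * u ^+ j) =
   (fun n => (a + b * x) * series (fun j => c j * u ^+ j) n +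
      b * series (fun j => (if j is i.+1 then c i else 0) * u ^+ j) n).
  apply/funext => n; rewrite /series /= !mulr_sumr -big_split /=.
  by apply: eq_bigr => j _; rewrite mulrDl !mulrA.
rewrite -mulrA; apply: cvgD; apply: cvgM => //; try exact: cvg_cst.
rewrite -cvg_shiftS.
have -> : (fun n => series (fun j => (if j is i.+1 then c i else 0) * u ^+ j) n.+1) =
    (fun n => u * series (fun j => c j * u ^+ j) n).
  apply/funext => n; rewrite /series /= big_nat_recl // mul0r add0r mulr_sumr.
  by apply: eq_bigr => i _; rewrite exprS mulrCA.
by apply: cvgM => //; exact: cvg_cst.
Qed.

(** Let x0 be the supremum of the points beyond x1 where A and B differ. They agree to the right of
    x0, so their expansions at x0 have equal coefficients and A = B on both sides near x0,
    contradicting the choice of x0. *)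
Lemma pseries_continuation A B :
  (forall x, 0 < x -> local_pseries A x) -> (forall x, 0 < x -> local_pseries B x) ->
  (forall x, 1 < x -> A x = B x) -> forall x, 0 < x -> A x = B x.
Proof.
move=> pA pB AB x1 x10; apply/eqP/negP => /negP nAB.
pose E := [set x | x1 <= x /\ A x <> B x].
have E1 : E x1 by split => //; apply/eqP.
have ub : ubound E 1.
  move=> x [_ nx]; rewrite leNgt; apply/negP => h; exact/nx/AB.
have hs : has_sup E by split; [exists x1|exists 1].
pose x0 := sup E.
have x1x0 : x1 <= x0 by apply: ub_le_sup E1; exists 1.
have x00 : 0 < x0 by exact: lt_le_trans x10 x1x0.
have right x : x0 < x -> A x = B x.
  move=> hx; apply/eqP/negP => /negP nx.
  have : x <= x0; last by rewrite leNgt hx.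
  apply: ub_le_sup; first by exists 1.
  by split; [exact/ltW/(le_lt_trans x1x0)|exact/eqP].
have [c [r [r0 H]]] := pA _ x00; have [d [t [t0 K]]] := pB _ x00.
pose w := Num.min r t; have w0 : 0 < w by rewrite lt_min r0.
have dif u : `|u| < w -> series (fun j => (c j - d j) * u ^+ j) @ \oo --> A (x0 + u) - B (x0 + u).
  rewrite lt_min => /andP[ur ut].
  have -> : series (fun j => (c j - d j) * u ^+ j) =
      (fun n => series (fun j => c j * u ^+ j) n - series (fun j => d j * u ^+ j) n).
    by apply/funext => n; rewrite /series /= -sumrB; apply: eq_bigr => j _; rewrite mulrBl.
  by apply: cvgB; [exact: H|exact: K].
have cd : forall j, c j - d j = 0.
  apply: (pseries_zero_coef w0) => u /andP[u0 uw].
  have := dif u; rewrite gtr0_norm // => /(_ uw).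
  by rewrite right ?subrr // ltrDl.
have loc u : `|u| < w -> A (x0 + u) = B (x0 + u).
  move=> uw; apply/eqP; rewrite -subr_eq0; apply/eqP.
  have := dif u uw.
  have -> : series (fun j => (c j - d j) * u ^+ j) = fun=> 0.
    by apply/funext => n; rewrite /series /= big1 // => j _; rewrite cd mul0r.
  by move=> h; rewrite -(cvg_lim (@Rhausdorff R) h) lim_cst.
have [y [y1 yE] hy] := sup_adherent w0 hs.
have yx0 : y <= x0 by apply: ub_le_sup; [exists 1|].
apply: yE; have := loc (y - x0); rewrite (addrC x0) subrK; apply.
rewrite ler0_norm ?subr_le0 // opprB; rewrite -/x0 in hy; lra.
Qed.

End local_power_series.

Section taylor.
Variable R : realType.
Implicit Types (a p q T x y : R).

(* [oscpow a p q T m x] is the real part of (p + i q) x^(-a - i T) m(ln x). *)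
Definition oscpow a p q T (m : R -> R) x : R :=
  expR (- a * ln x) * (p * cos (T * ln x) + q * sin (T * ln x)) * m (ln x).

(** Differentiating x^(-a - i T) multiplies p + i q by -(a + i T), which yields the new pair. *)
Lemma is_derive_oscpow a p q T (m dm : R -> R) x : 0 < x ->
  (forall y, is_derive y 1 m (dm y)) ->
  is_derive x 1 (oscpow a p q T m)
    (oscpow (a + 1) (- a * p + T * q) (- a * q - T * p) T m x + oscpow (a + 1) p q T dm x).
Proof.
move=> x0 hm.
pose G y := expR (- a * y) * (p * cos (T * y) + q * sin (T * y)) * m y.
have hG (y : R) : is_derive y 1 G (expR (- a * y) * ((- a * p + T * q) * cos (T * y) + (- a * q - T * p) * sin (T * y)) * m y
    + expR (- a * y) * (p * cos (T * y) + q * sin (T * y)) * dm y).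
  have := hm y => hmy.
  have h1 : is_derive y 1 (fun y => expR (- a * y)) (- a * expR (- a * y)).
    by apply: is_derive_eq; rewrite /GRing.scale /=; ring.
  have h2 : is_derive y 1 (fun y => p * cos (T * y) + q * sin (T * y)) (T * q * cos (T * y) - T * p * sin (T * y)).
    by apply: is_derive_eq; rewrite /GRing.scale /=; ring.
  have h3 := is_deriveM (is_deriveM h1 h2) hmy.
  have h4 : is_derive y 1 G _ := h3.
  apply: (is_derive_eq h4).
  rewrite /GRing.scale /= mulrfctE; ring.
have := is_derive1_comp (hG (ln x)) (is_derive1_ln x0).
rewrite (_ : G \o (ln (R:=R)) = oscpow a p q T m) // => h.
apply: (is_derive_eq h).
have -> : x^-1 = expR (- ln x) by rewrite expRN lnK.
rewrite /oscpow.
have -> : - (a + 1) * ln x = - a * ln x + - ln x by ring.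
rewrite expRD; ring.
Qed.

Lemma oscpow_le a p q T (m : R -> R) x M : `|m (ln x)| <= M ->
  `|oscpow a p q T m x| <= expR (- a * ln x) * (`|p| + `|q|) * M.
Proof.
move=> hm; rewrite /oscpow normrM ler_pM // normrM (ger0_norm (expR_ge0 _)).
rewrite ler_wpM2l ?expR_ge0 //.
apply: le_trans (ler_normD _ _) _; rewrite !normrM.
by apply: lerD; rewrite ler_piMr // ler_norml ?cos_geN1 ?cos_le1 ?sin_geN1 ?sin_le1.
Qed.

Lemma mean_value_le (f df : R -> R) x y (M : R) : x <= y ->
  (forall z, x <= z <= y -> is_derive z 1 f (df z)) ->
  (forall z, x <= z <= y -> `|df z| <= M) -> `|f y - f x| <= M * (y - x).
Proof.
move=> xy hf hM.
have [|/=|c] := @MVT_segment R f df x y xy.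
- by move=> z; rewrite in_itv /= => /andP[a b]; apply: hf; rewrite !ltW.
- apply: derivable_within_continuous => z; rewrite in_itv /= => zxy.
  by have h := hf z zxy; exact: ex_derive.
rewrite in_itv /= => cxy ->; rewrite normrM (ger0_norm (_ : 0 <= y - x)) ?subr_ge0 //.
by rewrite ler_wpM2r ?subr_ge0 // hM.
Qed.

(** The mean value theorem is used for f z - z f'(x), and again for f'. A regularised term thus has
    the size of a second derivative, whence the convergence of their series. *)
Lemma taylor2_le (f df ddf : R -> R) x (M : R) :
  (forall z, x <= z <= x + 1 -> is_derive z 1 f (df z)) ->
  (forall z, x <= z <= x + 1 -> is_derive z 1 df (ddf z)) ->
  (forall z, x <= z <= x + 1 -> `|ddf z| <= M) ->
  `|df x - (f (x + 1) - f x)| <= M.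
Proof.
move=> h1 h2 h3.
have M0 : 0 <= M.
  by apply: le_trans (h3 x _); rewrite ?normr_ge0 // lexx lerDl ler01.
have := @mean_value_le (fun z => f z - df x * z) (fun z => df z - df x) x (x + 1) M.
have -> : f (x + 1) - df x * (x + 1) - (f x - df x * x) = - (df x - (f (x + 1) - f x)) by ring.
have -> : M * (x + 1 - x) = M by ring.
rewrite normrN; apply; first by rewrite lerDl.
  move=> z hz; have := h1 z hz => d; apply: is_derive_eq; rewrite /GRing.scale /=; ring.
move=> z /andP[z1 z2]; apply: (@le_trans _ _ (M * (z - x))).
  apply: (@mean_value_le df ddf) => // t /andP[t1 t2]; [apply: h2|apply: h3];
  by rewrite t1 (le_trans t2).
by rewrite ler_piMr //; lra.
Qed.

(** Coefficient of u^j in exp(-u y); hence [oscpow a] with m = [emono j] is the coefficient of u^j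
    in [oscpow (a + u)] with m = 1. *)
Definition emono j y : R := (- y) ^+ j / j`!%:R.
(** On [emono] this is differentiation in y; on generating series in u it is multiplication by
    -u. *)
Definition shift_mono (f : nat -> R -> R) j y : R := if j is i.+1 then - f i y else 0.

Lemma is_derive_emono j y : is_derive y 1 (emono j) (shift_mono emono j y).
Proof.
case: j => [|j] /=.
  rewrite /emono; under eq_fun do rewrite expr0; exact: is_derive_cst.
have h := is_deriveZ (j.+1`!%:R^-1) (is_deriveX j.+1 (is_deriveN (is_derive_id y (1 : R)))).
have -> : emono j.+1 = j.+1`!%:R^-1 *: (- (@id R)) ^+ j.+1.
  by apply/funext => z; rewrite /emono mulrC fctE exprfctE.
apply: (is_derive_eq h).
rewrite /emono /GRing.scale /= factS natrM; field.
by rewrite addrC natr1 !pnatr_eq0 -lt0n fact_gt0.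
Qed.

Lemma is_derive_shift_emono j y :
  is_derive y 1 (shift_mono emono j) (shift_mono (shift_mono emono) j y).
Proof.
case: j => [|j] /=; first exact: is_derive_cst.
have h := is_derive_emono j y.
exact: is_deriveN.
Qed.

(** Write (r y)^j / j! as 2^(-j) (2 r y)^j / j! and bound the second factor by the exponential. The
    factor 2^(-j) serves the sum over j; with Y = ln (k + 2) the price is a small power of k. *)
Lemma emono_le (r y Y : R) j : 0 < r -> 0 <= y <= Y ->
  `|emono j y| * r ^+ j <= 2^-1 ^+ j * expR (2 * r * Y).
Proof.
move=> r0 /andP[y0 yY].
have Y0 : 0 <= Y by exact: le_trans yY.
rewrite /emono normrM normfV normrX normrN (ger0_norm y0) (normr_nat _ j`!).
have h : (2 * r * Y) ^+ j / j`!%:R <= expR (2 * r * Y).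
  have p0 : 0 <= 2 * r * Y by rewrite mulr_ge0 // mulr_ge0 // ltW.
  have [->|j0] := eqVneq j 0%N.
    by rewrite expr0 fact0 invr1 mulr1; apply: le_trans (expR_ge1Dx _); rewrite lerDl.
    by case: j j0 => // j _; apply: le_trans (expR_ge1Dxn j p0); rewrite lerDr.
apply: (@le_trans _ _ (2^-1 ^+ j * ((2 * r * Y) ^+ j / j`!%:R))); last first.
  by apply: ler_wpM2l => //; rewrite exprn_ge0 // invr_ge0.
rewrite [leRHS]mulrA -exprMn.
have -> : 2^-1 * (2 * r * Y) = r * Y by field.
rewrite mulrAC ler_wpM2r ?invr_ge0 // mulrC exprMn.
apply: ler_wpM2l; first by apply/exprn_ge0/ltW.
by apply: lerXn2r; rewrite ?nnegrE.
Qed.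

End taylor.

(** * The regularised terms of the zeta series *)

Section zeta_terms.
Variable R : realType.
Implicit Types (a p q T u x y d : R).

Lemma inv_power_telescope d k : 0 < d ->
  d * expR (- (1 + d) * ln k.+2%:R) <= expR (- d * ln k.+1%:R) - expR (- d * ln k.+2%:R).
Proof.
move=> d0.
have h := @ln_sub_ge R k.+1%:R k.+2%:R (ltr0Sn _ _).
have {h} : k.+2%:R^-1 <= ln k.+2%:R - ln k.+1%:R :> R.
  apply: le_trans (h _); last by rewrite ler_nat.
  have -> : k.+2%:R - k.+1%:R = 1 :> R by rewrite -[k.+2%:R]natr1 addrAC subrr add0r.
  by rewrite mul1r.
have -> : k.+2%:R^-1 = expR (- ln k.+2%:R) :> R by rewrite expRN lnK // posrE.
set y := ln k.+2%:R; set x := ln k.+1%:R => h.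
have -> : - (1 + d) * y = - d * y + - y by ring.
have -> : - d * x = - d * y + d * (y - x) by ring.
rewrite !expRD mulrCA -[X in _ <= _ - X]mulr1 -mulrBr ler_wpM2l ?expR_ge0 //.
have := @expR_ge1Dx R (d * (y - x)).
have : d * expR (- y) <= d * (y - x) by rewrite ler_wpM2l // ltW.
lra.
Qed.

Lemma sum_inv_power d m n : 0 < d -> (m <= n)%N ->
  \sum_(m <= k < n) expR (- (1 + d) * ln k.+2%:R) <= d^-1 * expR (- d * ln m.+1%:R).
Proof.
move=> d0 mn; rewrite ler_pdivlMl // mulr_sumr.
apply: (@le_trans _ _ (\sum_(m <= k < n) (expR (- d * ln k.+1%:R) - expR (- d * ln k.+2%:R)))).
  by apply: ler_sum => k _; exact: inv_power_telescope.
rewrite -[leLHS]opprK -sumrN; under eq_bigr do rewrite opprB.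
rewrite (@telescope_sumr _ m n (fun k => expR (- d * ln k.+1%:R))) // opprB.
by rewrite gerBl expR_ge0.
Qed.

Lemma inv_power_series_cvg d : 0 < d ->
  cvgn (series (fun k => expR (- (1 + d) * ln k.+1%:R) : R)).
Proof.
move=> d0; apply: nondecreasing_is_cvgn.
  by move=> m n mn; rewrite /series /= [leRHS](big_cat_nat (leq0n _) mn) //= lerDl sumr_ge0 // => k _; exact: expR_ge0.
exists (1 + d^-1) => _ [n _ <-]; case: n => [|n].
  by rewrite /series /= big_geq // addr_ge0 // invr_ge0 ltW.
rewrite /series /= big_nat_recl // ln1 mulr0 expR0 lerD2l.
have := @sum_inv_power d 0 n d0 (leq0n _).
by rewrite ln1 mulr0 expR0 mulr1.
Qed.

Lemma inv_power_tail d n : 0 < d ->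
  limn (series (fun k => expR (- (1 + d) * ln k.+1%:R) : R)) - series (fun k => expR (- (1 + d) * ln k.+1%:R)) n.+1 <=
  d^-1 * expR (- d * ln n.+1%:R).
Proof.
move=> d0; rewrite lerBlDr.
apply: limr_le; first exact: inv_power_series_cvg.
exists n.+1 => // m /= nm; rewrite -lerBlDr.
rewrite /series /= (big_cat_nat (leq0n _) nm) //= addrAC subrr add0r.
case: m nm => // m nm; rewrite big_add1 /=.
exact: sum_inv_power.
Qed.

(** The second derivative has four [oscpow] terms, and each differentiation multiplies |p| + |q| by
    at most L = 1 + |a| + |T|; hence 4 L^2. *)
Lemma oscpow_taylor a p q T (m dm ddm : R -> R) x (M : R) :
  0 <= a + 2 -> 1 <= x ->
  (forall y, is_derive y 1 m (dm y)) -> (forall y, is_derive y 1 dm (ddm y)) ->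
  (forall z, x <= z <= x + 1 -> [/\ `|m (ln z)| <= M, `|dm (ln z)| <= M & `|ddm (ln z)| <= M]) ->
  `|oscpow (a + 1) (- a * p + T * q) (- a * q - T * p) T m x + oscpow (a + 1) p q T dm x
     - (oscpow a p q T m (x + 1) - oscpow a p q T m x)| <=
  4 * (1 + `|a| + `|T|) ^+ 2 * (`|p| + `|q|) * M * expR (- (a + 2) * ln x).
Proof.
move=> a2 x1 hm hdm hM.
have M0 : 0 <= M.
  have xx : x <= x <= x + 1 by rewrite lexx lerDl ler01.
  by have [h _ _] := hM x xx; exact: le_trans h.
set p' := - a * p + T * q; set q' := - a * q - T * p.
apply: (@taylor2_le R (oscpow a p q T m) (fun z => oscpow (a + 1) p' q' T m z + oscpow (a + 1) p q T dm z)
  (fun z => (oscpow (a + 1 + 1) (- (a + 1) * p' + T * q') (- (a + 1) * q' - T * p') T m z + oscpow (a + 1 + 1) p' q' T dm z) +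
   (oscpow (a + 1 + 1) (- (a + 1) * p + T * q) (- (a + 1) * q - T * p) T dm z + oscpow (a + 1 + 1) p q T ddm z))).
- move=> z /andP[z1 z2]; apply: is_derive_oscpow => //; exact: lt_le_trans ltr01 (le_trans x1 z1).
- move=> z /andP[z1 z2]; have z0 : 0 < z by exact: lt_le_trans ltr01 (le_trans x1 z1).
  have h1 := is_derive_oscpow (a + 1) p' q' T z0 hm.
  have h2 := is_derive_oscpow (a + 1) p q T z0 hdm.
  exact: (is_deriveD h1 h2).
move=> z zx; have [m1 m2 m3] := hM z zx; case/andP: zx => z1 z2.
have z0 : 0 < z by exact: lt_le_trans ltr01 (le_trans x1 z1).
have Ez : expR (- (a + 1 + 1) * ln z) <= expR (- (a + 2) * ln x).
  have -> : a + 1 + 1 = a + 2 by ring.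
  rewrite ler_expR !mulNr lerN2 ler_wpM2l // ler_ln // posrE //; lra.
set E := expR (- (a + 2) * ln x) in Ez *.
have bd p0 q0 (f : R -> R) : `|f (ln z)| <= M -> `|oscpow (a + 1 + 1) p0 q0 T f z| <= (`|p0| + `|q0|) * (M * E).
  move=> hf; apply: le_trans (oscpow_le _ _ _ _ hf) _.
  rewrite -mulrA mulrC -mulrA; apply: ler_wpM2l; first by rewrite addr_ge0.
  by rewrite ler_wpM2l.
have rot b p0 q0 : `|- b * p0 + T * q0| + `|- b * q0 - T * p0| <= (`|b| + `|T|) * (`|p0| + `|q0|).
  have h1 := ler_normD (- b * p0) (T * q0); have h2 := ler_normB (- b * q0) (T * p0).
  rewrite !normrM !normrN in h1 h2; lra.
have aa : `|a + 1| <= `|a| + 1 by apply: le_trans (ler_normD _ _) _; rewrite normr1.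
set L := 1 + `|a| + `|T|; set S := `|p| + `|q|.
have S0 : 0 <= S by rewrite addr_ge0.
have L1 : 1 <= L by rewrite /L -addrA lerDl addr_ge0.
have k1 : `|p'| + `|q'| <= L * S.
  by apply: le_trans (rot _ _ _) _; rewrite ler_wpM2r // /L; lra.
have k2 : `|- (a + 1) * p' + T * q'| + `|- (a + 1) * q' - T * p'| <= L * (L * S).
  apply: le_trans (rot _ _ _) _; apply: ler_pM => //; rewrite ?addr_ge0 // /L; lra.
have k3 : `|- (a + 1) * p + T * q| + `|- (a + 1) * q - T * p| <= L * S.
  by apply: le_trans (rot _ _ _) _; rewrite ler_wpM2r // /L; lra.
have k4 : S <= L * S by rewrite ler_peMl.
have k5 : L * S <= L * (L * S) by rewrite ler_peMl // mulr_ge0 //; lra.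
have ME : 0 <= M * E by rewrite mulr_ge0 // expR_ge0.
set N := L * (L * S).
have g1 := le_trans (bd _ _ _ m1) (ler_wpM2r ME k2).
have g2 := le_trans (bd _ _ _ m2) (ler_wpM2r ME (le_trans k1 k5)).
have g3 := le_trans (bd _ _ _ m2) (ler_wpM2r ME (le_trans k3 k5)).
have g4 := le_trans (bd _ _ _ m3) (ler_wpM2r ME (le_trans k4 k5)).
have -> : 4 * L ^+ 2 * S * M * E = N * (M * E) + N * (M * E) + (N * (M * E) + N * (M * E)) by rewrite /N; ring.
apply: le_trans (ler_normD _ _) _; apply: lerD; apply: le_trans (ler_normD _ _) _; exact: lerD.
Qed.

Lemma emono_series u y : series (fun j => emono j y * u ^+ j) @ \oo --> expR (- u * y).
Proof.
have -> : (fun j => emono j y * u ^+ j) = exp_coeff (- u * y).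
  apply/funext => j; rewrite /emono /exp_coeff /= mulrAC -exprMn; congr (_ ^+ _ / _); ring.
exact: is_cvg_series_exp_coeff.
Qed.

Lemma oscpow_series a p q T x u :
  series (fun j => oscpow a p q T (emono j) x * u ^+ j) @ \oo --> oscpow (a + u) p q T (fun=> 1) x.
Proof.
have -> : oscpow (a + u) p q T (fun=> 1) x =
   expR (- a * ln x) * (p * cos (T * ln x) + q * sin (T * ln x)) * expR (- u * ln x).
  by rewrite /oscpow (_ : - (a + u) * ln x = - a * ln x + - u * ln x) ?expRD; ring.
have -> : series (fun j => oscpow a p q T (emono j) x * u ^+ j) =
   (fun n => expR (- a * ln x) * (p * cos (T * ln x) + q * sin (T * ln x)) * series (fun j => emono j (ln x) * u ^+ j) n).
  by apply/funext => n; rewrite /series /= mulr_sumr; apply: eq_bigr => j _; rewrite /oscpow !mulrA.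
by apply: cvgM; [exact: cvg_cst|exact: emono_series].
Qed.

Lemma oscpow_shift_series a p q T x u :
  series (fun j => oscpow a p q T (shift_mono (@emono R) j) x * u ^+ j) @ \oo --> - u * oscpow (a + u) p q T (fun=> 1) x.
Proof.
rewrite -cvg_shiftS.
have -> : (fun n => series (fun j => oscpow a p q T (shift_mono (@emono R) j) x * u ^+ j) n.+1) =
   (fun n => - u * series (fun j => oscpow a p q T (emono j) x * u ^+ j) n).
  apply/funext => n; rewrite /series /= big_nat_recl // {1}/oscpow /= mulr0 mul0r add0r mulr_sumr.
  by apply: eq_bigr => j _; rewrite /oscpow /= exprS; ring.
by apply: cvgM; [exact: cvg_cst|exact: oscpow_series].
Qed.

(* With s = a + 1 + i T, the real part of (p + i q) times
   (1 - s) n^(-s) - ((n + 1)^(1 - s) - n^(1 - s)) for n = k + 1;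
   over all n these sum to (1 - s) zeta(s) + 1. *)
Definition zterm p q T a k : R :=
  oscpow (a + 1) (- a * p + T * q) (- a * q - T * p) T (fun=> 1) k.+1%:R
  - (oscpow a p q T (fun=> 1) k.+2%:R - oscpow a p q T (fun=> 1) k.+1%:R).

(** Coefficient of u^j in [zterm] at a + u; the second summand is due to the -u contained in 1 - s.
    The whole is also f'(x) - (f(x + 1) - f(x)) for f = [oscpow] with m = [emono j], so
    [oscpow_taylor] bounds it. *)
Definition zterm_coef p q T a k j : R :=
  oscpow (a + 1) (- a * p + T * q) (- a * q - T * p) T (emono j) k.+1%:R
  + oscpow (a + 1) p q T (shift_mono (@emono R) j) k.+1%:R
  - (oscpow a p q T (emono j) k.+2%:R - oscpow a p q T (emono j) k.+1%:R).

Lemma zterm_series p q T a k u :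
  series (fun j => zterm_coef p q T a k j * u ^+ j) @ \oo --> zterm p q T (a + u) k.
Proof.
have -> : zterm p q T (a + u) k =
   oscpow (a + 1 + u) (- a * p + T * q) (- a * q - T * p) T (fun=> 1) k.+1%:R
   + - u * oscpow (a + 1 + u) p q T (fun=> 1) k.+1%:R
   - (oscpow (a + u) p q T (fun=> 1) k.+2%:R - oscpow (a + u) p q T (fun=> 1) k.+1%:R).
  rewrite /zterm; congr (_ - _); rewrite /oscpow (addrAC a u 1); ring.
have -> : series (fun j => zterm_coef p q T a k j * u ^+ j) = fun n =>
   series (fun j => oscpow (a + 1) (- a * p + T * q) (- a * q - T * p) T (emono j) k.+1%:R * u ^+ j) n
  + series (fun j => oscpow (a + 1) p q T (shift_mono (@emono R) j) k.+1%:R * u ^+ j) n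
  - (series (fun j => oscpow a p q T (emono j) k.+2%:R * u ^+ j) n
     - series (fun j => oscpow a p q T (emono j) k.+1%:R * u ^+ j) n).
  apply/funext => n; rewrite /series /= -sumrB -big_split /= -sumrB.
  by apply: eq_bigr => j _; rewrite /zterm_coef; ring.
apply: cvgB; last by apply: cvgB; exact: oscpow_series.
by apply: cvgD; [exact: oscpow_series|exact: oscpow_shift_series].
Qed.

Lemma zterm_le p q T a k : -1 < a ->
  `|zterm p q T a k| <= 4 * (1 + `|a| + `|T|) ^+ 2 * (`|p| + `|q|) * expR (- (1 + (a + 1)) * ln k.+1%:R).
Proof.
move=> a1.
have hc (c y : R) : is_derive y 1 (fun=> c : R) 0 by exact: is_derive_cst.
have := @oscpow_taylor a p q T (fun=> 1) (fun=> 0) (fun=> 0) k.+1%:R 1.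
have -> : 1 + (a + 1) = a + 2 by ring.
rewrite mulr1 {2}/oscpow mulr0 addr0 natr1; apply => //.
- lra.
- by rewrite ler1n.
- by move=> z _; rewrite normr1 normr0; split.
Qed.

(** [emono_le] costs a factor (k + 2)^(2 r). As 2 r <= 1 and 2 r <= (a + 1) / 2, this is at most 2
    (k + 1)^((a + 1) / 2): the constant 4 becomes 8, and half of the exponent a + 1 is left for
    summing over k. *)
Lemma zterm_coef_le p q T a (r : R) k j : -1 < a -> 0 < r -> r <= 2^-1 -> 4 * r <= a + 1 ->
  `|zterm_coef p q T a k j * r ^+ j| <=
  8 * (1 + `|a| + `|T|) ^+ 2 * (`|p| + `|q|) * expR (- (1 + (a + 1) / 2) * ln k.+1%:R) * 2^-1 ^+ j.
Proof.
move=> a1 r0 r1 ra.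
pose Y : R := ln k.+2%:R.
pose M := 2^-1 ^+ j * expR (2 * r * Y) / r ^+ j.
have rj : 0 < r ^+ j by rewrite exprn_gt0.
have lnz (z : R) : k.+1%:R <= z <= k.+1%:R + 1 -> 0 <= ln z <= Y.
  move=> /andP[z1 z2]; have z1' : 1 <= z by apply: le_trans z1; rewrite ler1n.
  rewrite ln_ge0 //= ler_ln ?posrE //; last exact: lt_le_trans z1'.
  by rewrite natr1 in z2.
(* Differentiation lowers the index while the factor r^j stays; the power of 1/2 counts the missing
   steps, and r <= 1/2 makes the property stable under [shift_mono]. *)
pose bounded (f : nat -> R -> R) := forall i y, (i <= j)%N -> 0 <= y <= Y ->
  `|f i y| * r ^+ i * 2^-1 ^+ (j - i) <= 2^-1 ^+ j * expR (2 * r * Y).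
have em : bounded (@emono R).
  move=> i y ij hy; have := @emono_le R r y Y i r0 hy => h.
  rewrite -[in leRHS](subnK ij) exprD mulrC -mulrA; exact: ler_wpM2l.
have shift f : bounded f -> bounded (shift_mono f).
  move=> fb [|i] y ij hy /=.
    by rewrite normr0 !mul0r mulr_ge0 ?expR_ge0 // exprn_ge0 // invr_ge0.
  apply: le_trans (fb i y (ltnW ij) hy); rewrite normrN exprS.
  have -> : (j - i)%N = (j - i.+1).+1 by rewrite subnSK.
  rewrite [in leRHS]exprS; set B := `|f i y|; set P := r ^+ i; set H := 2^-1 ^+ _.
  have -> : B * (r * P) * H = r * (B * P * H) by ring.
  have -> : B * P * (2^-1 * H) = 2^-1 * (B * P * H) by ring.
  have BPH : 0 <= B * P * H.
    apply: mulr_ge0; last by apply: exprn_ge0; rewrite invr_ge0.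
    by apply: mulr_ge0; [exact: normr_ge0|exact/exprn_ge0/ltW].
  exact: ler_wpM2r.
have := @oscpow_taylor a p q T (emono j) (shift_mono (@emono R) j)
  (shift_mono (shift_mono (@emono R)) j) k.+1%:R M.
rewrite natr1 -/(zterm_coef p q T a k j) => /(_ _ _ (is_derive_emono j) (is_derive_shift_emono j)) h.
have {}h : `|zterm_coef p q T a k j| <= 4 * (1 + `|a| + `|T|) ^+ 2 * (`|p| + `|q|) * M * expR (- (a + 2) * ln k.+1%:R).
  apply: h; [lra|by rewrite ler1n|].
  move=> z zk; have hz : 0 <= ln z <= Y by apply: lnz; rewrite natr1.
  have toM (v : R) : `|v| * r ^+ j * 2^-1 ^+ (j - j) <= 2^-1 ^+ j * expR (2 * r * Y) -> `|v| <= M.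
    by rewrite subnn expr0 mulr1 /M ler_pdivlMr.
  split; apply: toM; first exact: em.
  - exact: (shift _ em).
  - exact: (shift _ (shift _ em)).
rewrite normrM (ger0_norm (ltW rj)).
apply: le_trans (ler_wpM2r (ltW rj) h) _.
set C := 4 * (1 + `|a| + `|T|) ^+ 2 * (`|p| + `|q|).
have C0 : 0 <= C by rewrite mulr_ge0 ?addr_ge0 // mulr_ge0 // exprn_ge0 // !addr_ge0.
have -> : C * M * expR (- (a + 2) * ln k.+1%:R) * r ^+ j =
   C * 2^-1 ^+ j * (expR (2 * r * Y) * expR (- (a + 2) * ln k.+1%:R)).
  by rewrite /M; field; rewrite gt_eqF.
have -> : 8 * (1 + `|a| + `|T|) ^+ 2 * (`|p| + `|q|) * expR (- (1 + (a + 1) / 2) * ln k.+1%:R) * 2^-1 ^+ j =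
   C * 2^-1 ^+ j * (2 * expR (- (1 + (a + 1) / 2) * ln k.+1%:R)) by rewrite /C; ring.
rewrite ler_wpM2l //; first by rewrite mulr_ge0 // exprn_ge0 // invr_ge0.
have YE : Y <= ln 2 + ln k.+1%:R.
  rewrite -lnM ?posrE // /Y ler_ln ?posrE ?mulr_gt0 // -natrM ler_nat; lia.
have l0 : 0 <= ln k.+1%:R :> R by rewrite ln_ge0 // ler1n.
have l2 : 0 <= ln 2 :> R by rewrite ln_ge0 // ler1n.
have -> : 2 = expR (ln 2) :> R by rewrite lnK // posrE.
rewrite -!expRD ler_expR.
have -> : expR (ln 2) = 2 :> R by rewrite lnK // posrE.
have : 2 * r * Y <= 2 * r * (ln 2 + ln k.+1%:R) by rewrite ler_wpM2l // mulr_ge0 // ltW.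
have : 2 * r * ln 2 <= 1 * ln 2 :> R by rewrite ler_wpM2r //; lra.
have : 2 * r * ln k.+1%:R <= (a + 1) / 2 * ln k.+1%:R :> R by rewrite ler_wpM2r //; lra.
lra.
Qed.

Definition zsum p q T a : R := limn (series (zterm p q T a)).

Lemma zsum_cvg p q T a : -1 < a -> series (zterm p q T a) @ \oo --> zsum p q T a.
Proof.
move=> a1; apply: (@normed_cvg _ R^o); rewrite /normed_series_of /=.
have d0 : 0 < a + 1 by lra.
apply: (@series_le_cvg _ _ (fun k => 4 * (1 + `|a| + `|T|) ^+ 2 * (`|p| + `|q|) * expR (- (1 + (a + 1)) * ln k.+1%:R))) => //.
- by move=> k; exact: zterm_le.
exact: (@is_cvg_seriesZ R _ (4 * (1 + `|a| + `|T|) ^+ 2 * (`|p| + `|q|)) (inv_power_series_cvg d0)).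
Qed.

Lemma zsum_tail p q T a n : -1 < a ->
  `|zsum p q T a - series (zterm p q T a) n.+1| <=
  4 * (1 + `|a| + `|T|) ^+ 2 * (`|p| + `|q|) * ((a + 1)^-1 * expR (- (a + 1) * ln n.+1%:R)).
Proof.
move=> a1; have d0 : 0 < a + 1 by lra.
set C := 4 * _ * _.
have C0 : 0 <= C by rewrite mulr_ge0 ?addr_ge0 // mulr_ge0 // exprn_ge0 // !addr_ge0.
have h := @series_dominated R (zterm p q T a) (fun k => C * expR (- (1 + (a + 1)) * ln k.+1%:R)) (zsum p q T a) n.+1
   (C * limn (series (fun k => expR (- (1 + (a + 1)) * ln k.+1%:R)))).
have E : series (fun k => C * expR (- (1 + (a + 1)) * ln k.+1%:R)) =
   fun n => C * series (fun k => expR (- (1 + (a + 1)) * ln k.+1%:R)) n.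
  by apply/funext => m; rewrite /series /= mulr_sumr.
rewrite E in h.
apply: le_trans (h _ _ _) _.
- by move=> k; exact: zterm_le.
- exact: zsum_cvg.
- by apply: cvgM; [exact: cvg_cst|exact: inv_power_series_cvg].
by rewrite -mulrBr ler_wpM2l // inv_power_tail.
Qed.

(** For |u| <= r the double series is dominated by a summable function of k times 2^(-j), so
    [series_swap] turns the sum over k of power series into a single one. *)
Lemma zsum_local_pseries p q T x : 0 < x -> local_pseries (fun s => zsum p q T (s - 1)) x.
Proof.
move=> x0; pose a := x - 1.
have a1 : -1 < a by rewrite /a; lra.
pose r := Num.min (2^-1) ((a + 1) / 4).
have r0 : 0 < r by rewrite lt_min invr_gt0 ltr0n divr_gt0 // /a; lra.
have r1 : r <= 2^-1 by rewrite ge_min lexx.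
have r2 : 4 * r <= a + 1.
  have : r <= (a + 1) / 4 by rewrite ge_min lexx orbT.
  lra.
set C := 8 * (1 + `|a| + `|T|) ^+ 2 * (`|p| + `|q|).
have C0 : 0 <= C by rewrite mulr_ge0 ?addr_ge0 // mulr_ge0 // exprn_ge0 // !addr_ge0.
pose P k := C * expR (- (1 + (a + 1) / 2) * ln k.+1%:R).
have P0 k : 0 <= P k by rewrite mulr_ge0 // expR_ge0.
have d0 : 0 < (a + 1) / 2 by rewrite divr_gt0 //; lra.
have /cvg_ex[SP cP] : cvgn (series P) by exact: (@is_cvg_seriesZ R _ C (inv_power_series_cvg d0)).
pose q2 j : R := 2^-1 ^+ j.
have q20 j : 0 <= q2 j by rewrite exprn_ge0 // invr_ge0.
have cQ : series q2 @ \oo --> (1 / (1 - 2^-1) : R).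
  have := @cvg_geometric_series R 1 2^-1.
  have -> : geometric 1 2^-1 = q2 by apply/funext => j; rewrite /geometric /= mul1r.
  by apply; rewrite ger0_norm ?invr_ge0 // invf_lt1 // ltr1n.
pose A k j := zterm_coef p q T a k j.
have Abd k j u : `|u| <= r -> `|A k j * u ^+ j| <= P k * q2 j.
  move=> ur; apply: le_trans (zterm_coef_le p q T k j a1 r0 r1 r2).
  rewrite !normrM ler_wpM2l // !normrX.
  by rewrite lerXn2r ?nnegrE // (ger0_norm (ltW r0)).
have scv u j : `|u| <= r -> cvgn (series (fun k => A k j * u ^+ j)).
  move=> ur; apply: (@normed_cvg _ R^o); rewrite /normed_series_of /=.
  apply: (@series_le_cvg _ _ (fun k => q2 j * P k)) => //.
  - by move=> k; rewrite mulr_ge0.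
  - by move=> k; rewrite [leRHS]mulrC; exact: Abd.
  have cP' : cvgn (series P) by apply/cvg_ex; exists SP.
  exact: (@is_cvg_seriesZ R _ (q2 j) cP').
have rr : `|r| <= r by rewrite ger0_norm // ltW.
exists (fun j => limn (series (fun k => A k j))), r; split => // u ur.
have -> : x + u - 1 = a + u by rewrite /a; ring.
have au : -1 < a + u by have := ler_norm (- u); rewrite normrN; lra.
apply: (@series_swap R (fun k j => A k j * u ^+ j) (zterm p q T (a + u)) _ P q2 SP _ _ P0 q20 _ cP cQ).
- by move=> k j; apply: Abd; exact: ltW.
- by move=> k; exact: zterm_series.
(* The domination covers u = r; dividing by r^j gives the convergence of the coefficient itself. *)
- move=> j; have h : cvgn (series (fun k => A k j)).
    have rj : r ^+ j != 0 by rewrite expf_neq0 // gt_eqF.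
    have := @is_cvg_seriesZ R _ (r ^- j) (scv r j rr).
    have -> : (r ^- j) *: (fun k => A k j * r ^+ j) = (fun k => A k j) => //.
    by apply/funext => k; rewrite scalrfctE /GRing.scale /= mulrC -mulrA divff // mulr1.
  have -> : series (fun k => A k j * u ^+ j) = (fun n => series (fun k => A k j) n * u ^+ j).
    by apply/funext => n; rewrite /series /= mulr_suml.
  by apply: cvgM => //; exact: cvg_cst.
- exact: zsum_cvg.
Qed.

Lemma series_zterm p q T a n :
  series (zterm p q T a) n =
  series (fun k => oscpow (a + 1) (- a * p + T * q) (- a * q - T * p) T (fun=> 1) k.+1%:R) n
  - oscpow a p q T (fun=> 1) n.+1%:R + p.
Proof.
rewrite /series /= /zterm sumrB.
rewrite (@telescope_sumr _ 0 n (fun k => oscpow a p q T (fun=> 1) k.+1%:R)) //.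
have -> : oscpow a p q T (fun=> 1) 1 = p.
  by rewrite /oscpow ln1 !mulr0 expR0 cos0 sin0; ring.
by rewrite opprB addrA addrAC.
Qed.

End zeta_terms.

(** * Approximation of zeta by Dirichlet polynomials *)

Local Open Scope complex_scope.

Section complex_components.
Variable R : realType.
Implicit Types (p q x u T : R) (z w : R[i]).

(** The real part of (p + i q) z. Arbitrary p and q allow a complex factor such as 1 - s to be moved
    into the pair. *)
Definition component p q z : R := p * complex.Re z - q * complex.Im z.

Lemma componentB p q z w : component p q (z - w) = component p q z - component p q w.
Proof. by case: z => a b; case: w => c d; rewrite /component /=; ring. Qed.

Lemma component_sum p q (f : nat -> R[i]) n :
  component p q (series f n) = series (fun k => component p q (f k)) n.
Proof.
rewrite /series /=; elim: n => [|n IH].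
  by rewrite !big_geq // /component /= !mulr0 subr0.
rewrite !big_nat_recr //= -IH.
case: (\sum_(0 <= k < n) f k) => a b; case: (f n) => c d; rewrite /component /=; ring.
Qed.

Lemma componentZ p q z x : component p q (z * x%:C) = component p q z * x.
Proof. by case: z => a b; rewrite /component /=; ring. Qed.

Lemma component_le p q z (e : R) : `|z| <= e%:C -> `|component p q z| <= (`|p| + `|q|) * e.
Proof.
case: z => a b; rewrite normc_def lecR /= => h.
have e0 : 0 <= e by apply: le_trans h; exact: sqrtr_ge0.
have ha : `|a| <= e by apply: le_trans h; rewrite -sqrtr_sqr ler_wsqrtr // lerDl sqr_ge0.
have hb : `|b| <= e by apply: le_trans h; rewrite -[`|b|]sqrtr_sqr ler_wsqrtr // lerDr sqr_ge0.
rewrite /component /= mulrDl; apply: le_trans (ler_normB _ _) _.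
by rewrite !normrM; apply: lerD; rewrite ler_wpM2l.
Qed.

Lemma component_cvg p q (f : nat -> R[i]) z : (f : nat -> R[i]^o) @ \oo --> (z : R[i]^o) ->
  (fun n => component p q (f n)) @ \oo --> component p q z.
Proof.
move=> /cvgrPdist_le h; apply/cvg_epsP => e e0.
pose d := e / (`|p| + `|q| + 1).
have s0 : 0 <= `|p| + `|q| by rewrite addr_ge0.
have d0 : 0 < d by rewrite divr_gt0 // ltr_wpDl.
have [|N _ HN] := h d%:C; first by rewrite ltcR.
exists N => n Nn; rewrite -componentB.
apply: le_trans (component_le p q (HN n Nn)) _.
rewrite /d mulrA ler_pdivrMr ?ltr_wpDl // mulrC ler_wpM2l //; lra.
Qed.

Lemma analytic_local_pseries (f : R[i] -> R[i]) p q x T : analytic_at f (x +i* T) ->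
  local_pseries (fun y => component p q (f (y +i* T))) x.
Proof.
move=> [c /nbhs_ballP[e /= e0 he]].
(* A positive element of [R[i]] has imaginary part 0, so the radius is real. *)
have e1 : 0 < complex.Re e by case: e e0 {he} => a b; rewrite ltcE /= => /andP[].
have eE : e = (complex.Re e)%:C by case: e e0 {he e1} => a b; rewrite ltcE /= => /andP[/eqP -> _].
exists (fun j => component p q (c j)), (complex.Re e); split => // u ue.
have := he ((x + u) +i* T).
have uE : (x + u) +i* T - x +i* T = u%:C.
  by apply/eqP; rewrite eq_complex /=; apply/andP; split; apply/eqP; ring.
have hb : ball (x +i* T : R[i]^o) e ((x + u) +i* T : R[i]^o).
  rewrite -ball_normE /ball_ /= distrC uE normc_def /= expr0n addr0 sqrtr_sqr eE ltcR.
  exact: ue.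
move=> /(_ hb); rewrite /cseries_to uE => /component_cvg - /(_ p q).
have -> : (fun n => component p q (series (fun k => c k * u%:C ^+ k) n)) =
    series (fun j => component p q (c j) * u ^+ j).
  apply/funext => n; rewrite component_sum; congr (series _ n); apply/funext => k.
  by rewrite -rmorphXn componentZ.
exact.
Qed.

Lemma component_cexp p q x T k :
  component p q (cexp (- (x +i* T) * (ln k.+1%:R)%:C)) = oscpow x p q T (fun=> 1) k.+1%:R.
Proof.
have -> : - (x +i* T) * (ln k.+1%:R)%:C = (- x * ln k.+1%:R) +i* (- (T * ln k.+1%:R)) :> R[i].
  by apply/eqP; rewrite eq_complex /=; apply/andP; split; apply/eqP; ring.
rewrite /cexp /= cosN sinN /oscpow mulr1 /component /=; ring.
Qed.

Lemma inv_power_cvg0 (a : R) : 0 < a -> (fun n => expR (- a * ln n.+1%:R) : R) @ \oo --> (0 : R).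
Proof.
move=> a0; apply/cvg_epsP => e e0.
pose M := expR (- ln e / a).
exists (Num.truncn M) => n Mn; rewrite sub0r normrN ger0_norm ?expR_ge0 //.
have hM : M <= n.+1%:R by apply: le_trans (ltW (truncnS_gt M)) _; rewrite ler_nat.
have : - ln e / a <= ln n.+1%:R.
  by rewrite -[leLHS]expRK ler_ln ?posrE ?expR_gt0.
rewrite ler_pdivrMr // => h.
rewrite -[leRHS]lnK ?posrE // ler_expR; lra.
Qed.

(** * Continuation of zeta along horizontal lines *)

Section zeta.
Variable zeta : R[i] -> R[i].
Hypothesis zetaP : is_riemann_zeta zeta.

Lemma zeta_component_series p q T x : 1 < x ->
  series (fun k => oscpow x p q T (fun=> 1) k.+1%:R) @ \oo --> component p q (zeta (x +i* T)).
Proof.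
move=> x1; have [zser _ _] := zetaP.
have := component_cvg (p := p) (q := q) (zser (x +i* T) x1).
under eq_fun do rewrite component_sum.
by under [X in series X]eq_fun do rewrite component_cexp.
Qed.

(** For x > 1 telescoping leaves the Dirichlet series and a boundary term of order n^(1 - x), which
    vanishes. Both sides have local power series in x, since the line avoids s = 1, and the identity
    continues to x > 0. *)
Lemma zsum_zeta p q T x : T != 0 -> 0 < x ->
  zsum p q T (x - 1) =
  component (- (x - 1) * p + T * q) (- (x - 1) * q - T * p) (zeta (x +i* T)) + p.
Proof.
move=> T0; have [_ zan _] := zetaP.
pose Z P Q y := component P Q (zeta (y +i* T)).
have lps P Q y : local_pseries (Z P Q) y.
  apply: analytic_local_pseries; apply: zan; apply/eqP => -[_ /eqP].
  by rewrite (negbTE T0).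
move: x; apply: pseries_continuation => x x0.
- exact: zsum_local_pseries.
- have -> : (fun s => component (- (s - 1) * p + T * q) (- (s - 1) * q - T * p) (zeta (s +i* T)) + p) =
     (fun s => ((p + T * q) + - p * s) * Z 1 0 s + ((q - T * p) + - q * s) * Z 0 1 s + p).
    by apply/funext => s; rewrite /Z /component; ring.
  apply: local_pseriesD; last exact: local_pseries_cst.
  by apply: local_pseriesD; apply: local_pseries_affine.

have a0 : 0 < x - 1 by rewrite subr_gt0.
have lim := @zsum_cvg R p q T (x - 1) _.
apply: (cvg_unique (@Rhausdorff R) (lim _)) => //; first by lra.
have -> : series (zterm p q T (x - 1)) = fun n =>
   series (fun k => oscpow x (- (x - 1) * p + T * q) (- (x - 1) * q - T * p) T (fun=> 1) k.+1%:R) n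
   - oscpow (x - 1) p q T (fun=> 1) n.+1%:R + p.
  by apply/funext => n; rewrite series_zterm subrK.
apply: cvgD; last exact: cvg_cst.
rewrite -[X in _ --> X]subr0; apply: cvgB; first exact: zeta_component_series.
apply: (@cvg_le_dist _ _ (fun n => expR (- (x - 1) * ln n.+1%:R) * (`|p| + `|q|))) => [n|].
  have := @oscpow_le R (x - 1) p q T (fun=> 1) n.+1%:R 1.
  by rewrite sub0r normrN normr1 mulr1; apply.
rewrite -[X in _ --> X](mul0r (`|p| + `|q|)); apply: cvgM; last exact: cvg_cst.
exact: inv_power_cvg0.
Qed.

Lemma zeta_component_approx p q T x n : 2^-1 <= x <= 1 -> 1 <= `|T| -> `|p| + `|q| <= 1 ->
  `|component p q (zeta (x +i* T)) - series (fun k => oscpow x p q T (fun=> 1) k.+1%:R) n.+1| <=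
  2 / `|T| * expR ((1 - x) * ln n.+2%:R) + 144 * `|T| * expR (- x * ln n.+1%:R).
Proof.
move=> /andP[x1 x2] T1 pq1.
have T0 : T != 0 by rewrite -normr_gt0 (lt_le_trans ltr01).
pose a := x - 1.
have a1 : -1 < a by rewrite /a; lra.
have aa : `|a| <= 2^-1 by rewrite ler_norml /a; apply/andP; split; lra.
pose D := a ^+ 2 + T ^+ 2.
have D0 : 0 < D by rewrite ltr_wpDl ?sqr_ge0 // exprn_even_gt0.
(* p0 + i q0 is (p + i q) / (1 - s), which cancels the factor 1 - s of [zsum_zeta]; D is |1 -
   s|^2. *)
pose p0 := (- a * p - T * q) / D; pose q0 := (- a * q + T * p) / D.
have pE : - a * p0 + T * q0 = p.
  by rewrite /p0 /q0 [LHS](_ : _ = D * p / D); [rewrite mulrAC divff ?mul1r // gt_eqF|rewrite /D; ring].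
have qE : - a * q0 - T * p0 = q.
  by rewrite /p0 /q0 [LHS](_ : _ = D * q / D); [rewrite mulrAC divff ?mul1r // gt_eqF|rewrite /D; ring].
have S0 : `|p0| + `|q0| <= 2 / `|T|.
  rewrite /p0 /q0 !normrM !normfV (gtr0_norm D0) -mulrDl ler_pdivrMr //.
  have h1 : `|- a * p - T * q| + `|- a * q + T * p| <= (`|a| + `|T|) * (`|p| + `|q|).
    have h1 := ler_normB (- a * p) (T * q); have h2 := ler_normD (- a * q) (T * p).
    rewrite !normrM !normrN in h1 h2; lra.
  have h2 : (`|a| + `|T|) * (`|p| + `|q|) <= 2 * `|T|.
    apply: (@le_trans _ _ (`|a| + `|T|)); first by rewrite ler_piMr // addr_ge0.
    lra.
  apply: le_trans h1 (le_trans h2 _).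
  have -> : 2 * `|T| = 2 / `|T| * `|T| ^+ 2.
    by rewrite expr2 mulrA divfK // gt_eqF // (lt_le_trans ltr01).
  by rewrite ler_wpM2l ?divr_ge0 // /D real_normK ?num_real // lerDr sqr_ge0.
have x0 : 0 < x by lra.
have := @zsum_tail R p0 q0 T a n a1.
rewrite (zsum_zeta p0 q0 T0 x0) -/a series_zterm pE qE.
rewrite (_ : a + 1 = x); last by rewrite /a; ring.
set Z := component p q _; set S := series _ _; set O := oscpow _ _ _ _ _ _ => h.
have hO : `|O| <= 2 / `|T| * expR ((1 - x) * ln n.+2%:R).
  have hO : `|O| <= expR (- a * ln n.+2%:R) * (`|p0| + `|q0|) * 1.
    by apply: oscpow_le; rewrite normr1.
  apply: le_trans hO _; rewrite mulr1 mulrC /a opprB.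
  by rewrite ler_wpM2r // expR_ge0.
have {}h : `|Z + p0 - (S - O + p0)| <= 144 * `|T| * expR (- x * ln n.+1%:R).
  apply: le_trans h _.
  rewrite mulrA ler_wpM2r ?expR_ge0 //.
  have xi : x^-1 <= 2 by rewrite invf_ple ?posrE.
  have q1 : (1 + `|a| + `|T|) ^+ 2 <= (3 * `|T|) ^+ 2.
    by have := normr_ge0 a => ?; apply: lerXn2r; rewrite ?nnegrE; lra.
  (* This is where 144 = 4 x 9 x 2 x 2 comes from: 1 + |a| + |T| <= 3 |T|, |p0| + |q0| <= 2 / |T|
     and 1 / x <= 2. *)
  apply: (@le_trans _ _ (4 * (3 * `|T|) ^+ 2 * (2 / `|T|) * 2)).
    apply: ler_pM => //.
    - by rewrite invr_ge0 ltW.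
    apply: ler_pM => //; by rewrite ler_wpM2l.
  rewrite le_eqVlt; apply/orP; left; apply/eqP; field.
  by rewrite gt_eqF // (lt_le_trans ltr01).
have -> : Z - S = (Z + p0 - (S - O + p0)) - O by ring.
apply: le_trans (ler_normB _ _) _; rewrite addrC; exact: lerD.
Qed.

End zeta.

End complex_components.

(** * Mean square of the off-diagonal part *)

Section dirichlet_polynomial.
Variable R : realType.
Implicit Types (x tau y A : R) (K N Q : nat).

Definition dirichlet_weight x k : R := expR (- x * ln k.+1%:R).

Definition dirichlet_sqr x K tau : R :=
  (\sum_(k < K) dirichlet_weight x k * cos (tau * ln k.+1%:R)) ^+ 2
  + (\sum_(k < K) dirichlet_weight x k * sin (tau * ln k.+1%:R)) ^+ 2.

Definition off_diagonal x K tau : R :=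
  dirichlet_sqr x K tau - \sum_(k < K) dirichlet_weight x k ^+ 2.

Lemma sqr_trig_sum K (v : nat -> R) tau :
  (\sum_(k < K) v k * cos (tau * ln k.+1%:R)) ^+ 2
  + (\sum_(k < K) v k * sin (tau * ln k.+1%:R)) ^+ 2 - \sum_(k < K) v k ^+ 2
  = \sum_(p : 'I_K * 'I_K | p.1 != p.2)
      v p.1 * v p.2 * cos (tau * log_ratio R (p.1 : nat, p.2 : nat)).
Proof.
rewrite !expr2 !big_distrlr /= !pair_big /= -big_split /=.
rewrite (bigID (fun p : 'I_K * 'I_K => p.1 == p.2)) /=.
rewrite [X in X + _ - _](_ : _ = \sum_(k < K) v k ^+ 2); last first.
  rewrite -(pair_big_dep xpredT (fun i j : 'I_K => i == j)
    (fun i j : 'I_K => v i * cos (tau * ln i.+1%:R) * (v j * cos (tau * ln j.+1%:R)) +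
      v i * sin (tau * ln i.+1%:R) * (v j * sin (tau * ln j.+1%:R)))) /=.
  apply: eq_bigr => i _; rewrite (big_pred1 i) => [|j]; last by rewrite eq_sym.
  transitivity (v i ^+ 2 * (cos (tau * ln i.+1%:R) ^+ 2 + sin (tau * ln i.+1%:R) ^+ 2)); first by ring.
  by rewrite cos2Dsin2 mulr1.
rewrite addrAC subrr add0r; apply: eq_bigr => -[i j] _ /=.
by rewrite /log_ratio /= mulrBr cosB; ring.
Qed.

(** Zero weights pad polynomials of different lengths to one common set of pairs, as [osc_int_sqr]
    requires. *)
Lemma off_diagonal_trunc x K K' tau : (K <= K')%N ->
  let v k := if (k < K)%N then dirichlet_weight x k else 0 in
  off_diagonal x K tau = \sum_(p : 'I_K' * 'I_K' | p.1 != p.2)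
      v p.1 * v p.2 * cos (tau * log_ratio R (p.1 : nat, p.2 : nat)).
Proof.
move=> KK' v; rewrite -sqr_trig_sum /off_diagonal /dirichlet_sqr.
have tr (f : nat -> R) : \sum_(k < K) dirichlet_weight x k * f k = \sum_(k < K') v k * f k.
  rewrite (big_ord_widen K' (fun k => dirichlet_weight x k * f k) KK') big_mkcond /=.
  by apply: eq_bigr => k _; rewrite /v; case: ifP; rewrite ?mul0r.
rewrite (tr (fun k => cos (tau * ln k.+1%:R))) (tr (fun k => sin (tau * ln k.+1%:R))).
congr (_ - _).
under eq_bigr do rewrite expr2; rewrite (tr (dirichlet_weight x)).
by apply: eq_bigr => k _; rewrite expr2 /v; case: ifP; rewrite ?mul0r.
Qed.

(** Here y stands for a_1 and [b] for the phase due to t and the other coefficients. The factor 32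
    is 8 from [osc_int_sqr] times 4 from [sum_pair_weight_log]. *)
Lemma osc_int_off_diagonal x A K N (Kn : nat -> nat) (b : nat -> R) kappa : 0 <= A -> 0 <= kappa ->
  (forall k, (k < K)%N -> dirichlet_weight x k <= kappa / k.+1%:R) ->
  (forall n, (n < N)%N -> (Kn n <= K)%N) ->
  osc_int A (fun y => (\sum_(n < N) off_diagonal x (Kn n) (b n + y * n.+1%:R)) ^+ 2)
    (N%:R * (kappa * harm R K) ^+ 2 * ((A + 32 * harm R N) * (kappa * harm R K) ^+ 2)).
Proof.
move=> A0 k0 wk KnK.
pose v (p : 'I_K * 'I_K) := dirichlet_weight x p.1 * dirichlet_weight x p.2.
pose vt n k := if (k < Kn n)%N then dirichlet_weight x k else 0.
have w0 k : 0 <= dirichlet_weight x k by exact: expR_ge0.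
have v0 p : 0 <= v p by rewrite mulr_ge0.
have sv : \sum_p v p <= (kappa * harm R K) ^+ 2 by exact: sum_pair_weight.
have sl : \sum_p v p / `|log_ratio R (p.1 : nat, p.2 : nat)| <= 4 * (kappa * harm R K) ^+ 2.
  exact: sum_pair_weight_log.
have vtP n (p : 'I_K * 'I_K) : (n < N)%N -> 0 <= vt n p.1 * vt n p.2 <= v p.
  move=> _; rewrite /vt /v; case: ifP => _; case: ifP => _; rewrite ?mul0r ?mulr0 ?lexx ?mulr_ge0 //=.
have := @osc_int_sqr R A N ('I_K * 'I_K)%type (fun p => p.1 != p.2) v
  (fun p => log_ratio R (p.1 : nat, p.2 : nat)) (fun n p => vt n p.1 * vt n p.2)
  (fun n p => b n * log_ratio R (p.1 : nat, p.2 : nat)) A0 _ vtP.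
move=> H; have {}H := H (fun p hp => @log_ratio_neq0 R (p.1 : nat, p.2 : nat) hp).
apply: osc_intW; last first.
  apply: osc_int_ext H => y; congr (_ ^+ 2); apply: eq_bigr => n _.
  rewrite (off_diagonal_trunc _ _ (KnK n (ltn_ord n))).
  by apply: eq_bigr => p _; congr (_ * cos _); ring.
set S := (kappa * harm R K) ^+ 2 in sv sl *.
have S0 : 0 <= S by exact: sqr_ge0.
have h0 := harm_ge0 R N.
apply: ler_pM.
- by rewrite mulr_ge0 // sumr_ge0.
- rewrite addr_ge0 ?mulr_ge0 ?sumr_ge0 // => p _.
  by rewrite mulr_ge0 // invr_ge0.
- by rewrite ler_wpM2l.
have -> : (A + 32 * harm R N) * S = A * S + 8 * harm R N * (4 * S) by ring.
by apply: lerD; rewrite ler_wpM2l // mulr_ge0.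
Qed.

Lemma harm_ln K : harm R K.+1 <= 1 + ln K.+1%:R.
Proof.
elim: K => [|K IH]; first by rewrite /harm big_ord1 ln1 addr0 invr1.
have h : K.+1%:R <= K.+2%:R :> R by rewrite ler_nat.
have := ln_sub_ge (ltr0Sn R K) h.
have -> : K.+2%:R - K.+1%:R = 1 :> R by rewrite -[K.+2%:R]natr1 addrAC subrr add0r.
rewrite mul1r => h2.
have -> : harm R K.+2 = harm R K.+1 + K.+2%:R^-1 by rewrite /harm big_ord_recr.
set u := K.+2%:R^-1 in h2 *; set v := ln K.+2%:R in h2 *; set z := ln K.+1%:R in IH h2.
lra.
Qed.

(** With K = (j + 1)^(4 Q) and kappa = K^(1 - x), kappa^4 = (j + 1)^(16 Q (1 - x)) <= j + 1. The
    harmonic sums occur to the fifth power, each at most (1 + 20 Q) (j + 1)^(1/5), and contribute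
    another j + 1. Against 1 / N = (j + 1)^(-4) this leaves (j + 1)^(-2), with the exponent in the
    shape of [inv_power_series_cvg]. *)
Lemma osc_int_off_diagonal_mean x A Q j (b : nat -> R) : 0 <= A -> (0 < Q)%N -> x <= 1 -> 16 * Q%:R * (1 - x) <= 1 ->
  osc_int A (fun y => ((j.+1 ^ 4)%N%:R^-1 *
      \sum_(n < j.+1 ^ 4) off_diagonal x (n.+1 ^ Q) (b n + y * n.+1%:R)) ^+ 2)
    ((A + 32) * (1 + 20 * Q%:R) ^+ 5 * expR (- (1 + 1) * ln j.+1%:R)).
Proof.
move=> A0 Q0 x1 Qx; set N := (j.+1 ^ 4)%N; pose K := (N ^ Q)%N.
have N0 : (0 < N)%N by rewrite expn_gt0.
have K0 : (0 < K)%N by rewrite expn_gt0 N0.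
pose l : R := ln j.+1%:R.
have l0 : 0 <= l by rewrite ln_ge0 // ler1n.
have jE : j.+1%:R = expR l by rewrite lnK ?posrE.
have lK : ln K%:R = 4 * Q%:R * l :> R.
  have -> : K%:R = expR ((4 * Q)%N%:R * l) :> R by rewrite /K /N -expnM natrX jE -expRM_natl.
  by rewrite expRK natrM.
pose kappa := expR ((1 - x) * ln K%:R).
have k0 : 0 <= kappa by exact: expR_ge0.
have wk k : (k < K)%N -> dirichlet_weight x k <= kappa / k.+1%:R.
  move=> kK; rewrite ler_pdivlMr ?ltr0n // -[k.+1%:R in leLHS]lnK ?posrE ?ltr0n //.
  rewrite /dirichlet_weight -expRD ler_expR.
  have -> : - x * ln k.+1%:R + ln k.+1%:R = (1 - x) * ln k.+1%:R :> R by ring.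
  rewrite ler_wpM2l ?subr_ge0 // ler_ln ?posrE ?ltr0n //.
  by rewrite ler_nat.
have Kn n : (n < N)%N -> (n.+1 ^ Q <= K)%N.
  move=> nN; rewrite /K; by rewrite leq_exp2r.
have H := @osc_int_off_diagonal x A K N (fun n => n.+1 ^ Q)%N b kappa A0 k0 wk Kn.
apply: osc_intW; last first.
  apply: (osc_int_ext _ (osc_intZ (N%:R^-1 ^+ 2) H)) => y.
  by rewrite exprMn.
rewrite ger0_norm ?sqr_ge0 //.
set h := harm R K.
have hN : harm R N <= h by apply: harm_le; rewrite /K -{1}(expn1 N) leq_pexp2l.
have h1 : 1 <= h by exact: harm_ge1.
have hb : h <= (1 + 20 * Q%:R) * expR (l / 5).
  have hl : h <= 1 + 4 * Q%:R * l by rewrite -lK /h -(prednK K0); exact: harm_ln.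
  have := @expR_ge1Dx R (l / 5) => e5.
  have q0 : 0 <= Q%:R :> R by [].
  nra.
have k4 : kappa ^+ 4 <= expR l.
  rewrite /kappa -expRM_natl ler_expR lK.
  have := ler_wpM2r l0 Qx; rewrite -[4%:R]/(4 : R); lra.
have h5 : h ^+ 5 <= (1 + 20 * Q%:R) ^+ 5 * expR l.
  have -> : expR l = expR (l / 5) ^+ 5 by rewrite -expRM_natl; congr expR; field.
  have h0 : 0 <= h by exact: le_trans h1.
  by rewrite -exprMn; apply: lerXn2r => //; rewrite nnegrE // (le_trans h0).
have NE : N%:R = expR (4 * l) :> R by rewrite /N natrX jE -expRM_natl.
have NV : N%:R^-1 = expR (- (4 * l)) :> R by rewrite expRN NE.
have Nn : N%:R != 0 :> R by rewrite pnatr_eq0 -lt0n.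
have h0 : 0 <= h by exact: le_trans h1.
apply: (@le_trans _ _ (N%:R^-1 * (kappa ^+ 4 * h ^+ 4 * ((A + 32) * h)))).
  rewrite [leLHS](_ : _ = N%:R^-1 * (kappa ^+ 4 * h ^+ 4 * (A + 32 * harm R N))); last by field.
  rewrite ler_wpM2l ?invr_ge0 // ler_wpM2l //; first by rewrite mulr_ge0 // exprn_ge0.
  rewrite [leRHS]mulrDl; apply: lerD; last by rewrite ler_wpM2l.
  by rewrite ler_peMr.
apply: (@le_trans _ _ (expR (- (4 * l)) * (expR l * ((A + 32) * ((1 + 20 * Q%:R) ^+ 5 * expR l))))).
  rewrite NV ler_wpM2l ?expR_ge0 //.
  rewrite [leLHS](_ : _ = kappa ^+ 4 * ((A + 32) * h ^+ 5)); last by ring.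
  apply: ler_pM => //; rewrite ?exprn_ge0 // ?mulr_ge0 ?exprn_ge0 ?addr_ge0 //.
  by rewrite ler_wpM2l ?addr_ge0.
rewrite le_eqVlt; apply/orP; left; apply/eqP; rewrite -/l.
have -> : - (1 + 1) * l = - (4 * l) + (l + l) by ring.
rewrite !expRD; ring.
Qed.

End dirichlet_polynomial.

(** * Convergence almost everywhere *)

Section almost_everywhere.
Variable R : realType.
Local Notation mu := (@lebesgue_measure R).

Lemma osc_int_integral (A : R) (f : R -> R) (B : R) : 0 < A -> continuous f ->
  osc_int A f B -> (\int[mu]_(x in `[0%R, A]) (f x)%:E <= B%:E)%E.
Proof.
move=> A0 cf [F [dF FB]].
have cF : continuous F.
  move=> x; have h := dF x.
  by apply: differentiable_continuous; apply/derivable1_diffP; exact: ex_derive.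
rewrite (@continuous_FTC2 R f F) //.
- by rewrite -EFinB lee_fin; exact: le_trans (ler_norm _) FB.
- exact: continuous_subspaceT.
- split.
  + by move=> x _; have h := dF x; exact: ex_derive.
  + by apply: cvg_at_right_filter; exact: cF.
  + by apply: cvg_at_left_filter; exact: cF.
- by move=> x _; have h := dF x; rewrite derive1E; exact: derive_val.
Qed.

Lemma nneseries_lt_pinfty_cvg0 (u : nat -> R) : (forall j, 0 <= u j) ->
  (\sum_(j <oo) (u j)%:E < +oo)%E -> u @ \oo --> (0 : R).
Proof.
move=> u0 h; apply: cvg_series_cvg_0.
have n0 : (0 <= \sum_(j <oo) (u j)%:E)%E by apply: nneseries_ge0 => j _ _; rewrite lee_fin.
have fin : (\sum_(j <oo) (u j)%:E)%E \is a fin_num by rewrite ge0_fin_numE.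
apply: nondecreasing_is_cvgn.
  by move=> m n mn; rewrite /series /= [leRHS](big_cat_nat (leq0n _) mn) //= lerDl sumr_ge0.
exists (fine (\sum_(j <oo) (u j)%:E)%E) => _ [n _ <-].
rewrite -lee_fin fineK // /series /= -sumEFin.
by apply: nneseries_lim_ge => j _ _; rewrite lee_fin.
Qed.

Lemma series_cvg_nneseries_lt_pinfty (u : nat -> R) : (forall j, 0 <= u j) ->
  cvgn (series u) -> (\sum_(j <oo) (u j)%:E < +oo)%E.
Proof.
move=> u0 /cvg_ex[/= l ul]; apply: (@le_lt_trans _ _ l%:E); last exact: ltry.
apply: lime_le.
  by apply: is_cvg_nneseries => j _ _; rewrite lee_fin.
near=> n; rewrite sumEFin lee_fin.
exact: (@series_le_lim R u l n u0 ul).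
Unshelve. all: by end_near.
Qed.

Variables (d : measure_display) (T : measurableType d).
Variable nu : {sigma_finite_measure set T -> \bar R}.

(** The product measure integrates the measures of sections over the first coordinate, whereas the
    estimates fix the second one; uniqueness of the product measure exchanges the order. *)
Lemma null_of_null_ysections (Z : set (measurableTypeR R * T)) : measurable Z ->
  (forall t, mu (ysection Z t) = 0%E) -> (mu \x nu)%E Z = 0%E.
Proof.
move=> mZ hZ.
rewrite (@product_measure_unique _ _ _ _ R mu nu (mu \x^ nu)%E) //; last first.
  by move=> A B mA mB; exact: product_measure2E.
transitivity (\int[nu]_t mu (ysection Z t))%E; first by [].
by rewrite (eq_integral (cst 0%E)) ?integral0 // => t _; rewrite hZ.
Qed.

(** By Tonelli the sum of the squares of the [Y j] has finite integral over [0, A + 1], so it is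
    finite almost everywhere there and its terms tend to 0. The intervals for natural A exhaust the
    half-line. *)
Lemma osc_int_cvg_ae (Y : nat -> measurableTypeR R * T -> R) (B : nat -> nat -> R) :
  (forall j, measurable_fun setT (Y j)) ->
  (forall j t, continuous (fun x : R => Y j (x, t))) ->
  (forall A j t, osc_int A.+1%:R (fun x => Y j (x, t) ^+ 2) (B A j)) ->
  (forall A, cvgn (series (B A))) ->
  exists Z : set (measurableTypeR R * T), [/\ measurable Z, (mu \x nu)%E Z = 0%E &
    forall x t, ~ Z (x, t) -> 0 <= x -> 0 < x /\ (fun j => Y j (x, t)) @ \oo --> (0 : R)].
Proof.
move=> mY cY hY hB.
have B0 A j : 0 <= B A j.
  have [F [_ h]] := hY A j point; exact: le_trans h.
pose f p : \bar R := (\sum_(j <oo) (Y j p ^+ 2)%:E)%E.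
pose g j p : \bar R := (Y j p ^+ 2)%:E.
have mY2 j : @measurable_fun _ _ (measurableTypeR R * T)%type (\bar R) setT (g j).
  by apply/measurable_EFinP; exact: measurable_funX.
have mf : @measurable_fun _ _ (measurableTypeR R * T)%type (\bar R) setT f.
  apply: (@ge0_emeasurable_sum _ _ R setT g xpredT) => [k p _ _|k _]; last exact: mY2.
  by rewrite lee_fin sqr_ge0.
(* This null set is excluded so that a_1 > 0 outside Z, as [zeta_cmod_approx_cvg0] requires. *)
pose Z1 := [set p : measurableTypeR R * T | p.1 = 0].
pose Z2 := [set p : measurableTypeR R * T | 0 <= p.1] `&` [set p | f p = +oo%E].
have mZ1 : measurable Z1.
  have -> : Z1 = setT `&` fst @^-1` [set 0] by rewrite setTI.
  by apply: measurable_fst => //; exact: measurable_set1.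
have mZ2 : measurable Z2.
  apply: measurableI.
    have -> : [set p : measurableTypeR R * T | 0 <= p.1] = setT `&` fst @^-1` `[0, +oo[%classic.
      by rewrite setTI; apply/seteqP; split => p /=; rewrite in_itv /= andbT.
    by apply: measurable_fst => //; exact: measurable_itv.
  rewrite -[X in measurable X]setTI; apply: measurable_eqe => //; exact: measurable_cst.
exists (Z1 `|` Z2); split; first exact: measurableU.
  apply: null_of_null_ysections; first exact: measurableU.
  move=> t; apply: measure_negligible.
    by apply: measurable_ysection; exact: measurableU.
  pose Nk k : set R := if k is k'.+1 then ~` [set x | `[0, k'.+1%:R]%classic x -> f (x, t) \is a fin_num] else [set 0].
  apply: (@negligibleS _ _ _ mu (\bigcup_k Nk k)); last first.
    apply: negligible_bigcup => -[|A] /=.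
      apply/negligibleP; first exact: measurable_set1.
      exact: lebesgue_measure_set1.
    apply: (@integrable_ae _ _ R mu `[0, A.+1%:R]%classic _ (fun x => f (x, t))).
      exact: measurable_itv.
    have mx : measurable_fun setT (fun x : measurableTypeR R => (x, t)).
      exact: measurable_pair2.
    have A0 : 0 < A.+1%:R :> R by [].
    apply/integrableP; split.
      apply: (@measurable_funS _ _ _ _ setT) => //.
      exact: (measurableT_comp mf mx).
    rewrite (eq_integral (fun x => \sum_(j <oo) g j (x, t))%E); last first.
      by move=> x _; rewrite gee0_abs // nneseries_ge0 // => j _ _; rewrite lee_fin sqr_ge0.
    rewrite (@integral_nneseries _ _ R mu _ _ (fun j x => g j (x, t))); first last.
    - by move=> n x _; rewrite lee_fin sqr_ge0.
    - move=> n; apply: (@measurable_funS _ _ _ _ setT) => //.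
      exact: (measurableT_comp (mY2 n) mx).
    - exact: measurable_itv.
    apply: (@le_lt_trans _ _ (\sum_(j <oo) (B A j)%:E)%E); last exact: series_cvg_nneseries_lt_pinfty.
    apply: lee_nneseries => [j _ _|j _].
      by apply: integral_ge0 => x _; rewrite lee_fin sqr_ge0.
    apply: osc_int_integral => // x.
    by rewrite /=; apply: (@continuous_comp _ _ _ (fun x : R => Y j (x, t)) (fun y => y ^+ 2)); [exact: cY|exact: exprn_continuous].
  move=> x /=; rewrite /ysection /= inE => -[/= x0|[/= x0 xoo]]; first by exists 0%N.
  exists (Num.truncn x).+1 => //= h.
  have hx : x \in `[0, (Num.truncn x).+1%:R] by rewrite in_itv /= x0 /= ltW // truncnS_gt.
  by have := h hx; rewrite xoo.
move=> x t nZ x0; split.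
  by rewrite lt_neqAle x0 andbT; apply/negP => /eqP h; apply: nZ; left.
have flt : (f (x, t) < +oo)%E.
  by rewrite ltey; apply/negP => /eqP h; apply: nZ; right.
have := nneseries_lt_pinfty_cvg0 (fun j => sqr_ge0 (Y j (x, t))) flt.
move=> /cvg_epsP h; apply/cvg_epsP => e e0.
have [|N HN] := h (e ^+ 2); first by rewrite exprn_gt0.
exists N => n Nn; have := HN n Nn; rewrite !sub0r !normrN normrX.
by rewrite ler_pXn2r // nnegrE ltW.
Qed.

End almost_everywhere.

(** * The mean square of zeta *)

Lemma recursive_addn k (f : k.-tuple nat -> nat) m :
  recursive f -> recursive (fun v => f v + m)%N.
Proof.
move=> rf; elim: m => [|m IH].
  by have -> : (fun v => f v + 0)%N = f by apply/funext => v; rewrite addn0.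
have -> : (fun v => f v + m.+1)%N =
    (fun v : k.-tuple nat => (thead [tuple (f v + m)%N | i < 1]).+1).
  by apply/funext => v; rewrite /thead tnth_mktuple addnS.
exact: (recursive_comp (f := fun _ v => (f v + m)%N) recursive_succ).
Qed.

Lemma recursive_muln_thead k m l :
  recursive (fun v : k.+1.-tuple nat => thead v * m + l)%N.
Proof.
(* Entry 1 of the argument of the step function is the previous value, to which m is added. *)
apply: (@recursive_primrec k (fun=> 0 + l)%N
  (fun v : k.+2.-tuple nat => tnth v (inord 1) + m)%N).
- exact/recursive_addn/recursive_zero.
- exact/recursive_addn/recursive_proj.
- by move=> v; rewrite theadE.
- move=> n v; rewrite (tnth_nth 0%N) inordK //= !theadE; lia.
Qed.

Section mean_square.
Variable R : realType.
Implicit Types (x y t : R) (d n Q : nat).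

(** With Q = 2 (d + 1), sigma > [threshold d] says that 16 Q (1 - sigma) < 1. *)
Definition threshold d : R := 1 - (32 * d.+1)%N%:R^-1.

Lemma threshold_computable : computable_real_seq threshold.
Proof.
(* The value is the rational (32 n + 31) / (32 n + 32), returned exactly for every precision k; the
   denominator is [(q v).+1]. *)
exists (fun=> 0%N), (fun v => thead v * 32 + 31)%N, (fun v => thead v * 32 + 31)%N; split.
- exact: recursive_zero.
- exact: recursive_muln_thead.
- exact: recursive_muln_thead.
move=> n k /=; rewrite theadE expr0 mul1r /threshold.
have -> : (32 * n.+1 = (n * 32 + 31).+1)%N by lia.
set m := (n * 32 + 31)%N.
have m0 : m.+1%:R != 0 :> R by rewrite pnatr_eq0.
have -> : 1 - m.+1%:R^-1 - m%:R / m.+1%:R = 0 :> R.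
  have -> : m%:R = m.+1%:R - 1 :> R by rewrite -natr1 addrK.
  by move: m.+1%:R m0 => c c0; field.
by rewrite normr0 invr_ge0 exprn_ge0.
Qed.

Lemma threshold_cvg : threshold n @[n --> \oo] --> (1 : R).
Proof.
apply: (@cvg_le_dist R threshold harmonic) => [n|]; last exact: cvg_harmonic.
rewrite /threshold opprB addrC subrK ger0_norm ?invr_ge0 // /harmonic /=.
by rewrite lef_pV2 ?posrE ?ltr0n ?muln_gt0 // ler_nat leq_pmull.
Qed.

Lemma threshold_itv d : 2^-1 < threshold d < 1.
Proof.
rewrite /threshold; set m := (32 * d.+1)%N%:R.
have m2 : 32 <= m :> R by rewrite ler_nat leq_pmulr.
have m0 : 0 < m by exact: lt_le_trans m2.
have : m^-1 <= 32^-1 by rewrite lef_pV2 ?posrE.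
have : 0 < m^-1 by rewrite invr_gt0.
by move: m^-1 => c; lra.
Qed.

Lemma sqrt_sqrD_dist (a' b' c' e' : R) :
  `|Num.sqrt (a' ^+ 2 + b' ^+ 2) - Num.sqrt (c' ^+ 2 + e' ^+ 2)| <= `|a' - c'| + `|b' - e'|.
Proof.
have key (a b c e : R) : Num.sqrt (a ^+ 2 + b ^+ 2) <= Num.sqrt (c ^+ 2 + e ^+ 2) + (`|a - c| + `|b - e|).
  set s := Num.sqrt (c ^+ 2 + e ^+ 2).
  have s0 : 0 <= s by exact: sqrtr_ge0.
  have sE : s ^+ 2 = c ^+ 2 + e ^+ 2 by rewrite sqr_sqrtr // addr_ge0 // sqr_ge0.
  have cs : `|c| <= s by rewrite -sqrtr_sqr ler_wsqrtr // lerDl sqr_ge0.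
  have es : `|e| <= s by rewrite -[`|e|]sqrtr_sqr ler_wsqrtr // lerDr sqr_ge0.
  have [u0 v0] := (normr_ge0 (a - c), normr_ge0 (b - e)).

  have r0 : 0 <= s + (`|a - c| + `|b - e|) by rewrite !addr_ge0.
  rewrite -[leRHS](ger0_norm r0) -[leRHS]sqrtr_sqr ler_wsqrtr //.
  have ha : a ^+ 2 <= c ^+ 2 + 2 * (s * `|a - c|) + `|a - c| ^+ 2.
    rewrite real_normK ?num_real //.
    have : c * (a - c) <= s * `|a - c|.
      by apply: le_trans (ler_norm _) _; rewrite normrM ler_wpM2r.
    nra.
  have hb : b ^+ 2 <= e ^+ 2 + 2 * (s * `|b - e|) + `|b - e| ^+ 2.
    rewrite real_normK ?num_real //.
    have : e * (b - e) <= s * `|b - e|.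
      by apply: le_trans (ler_norm _) _; rewrite normrM ler_wpM2r.
    nra.
  have := mulr_ge0 u0 v0; nra.
rewrite ler_norml; apply/andP; split; last by rewrite lerBlDl; exact: key.
by have := key c' e' a' b'; rewrite (distrC c') (distrC e'); lra.
Qed.

Lemma continuous_sum_ord (f : nat -> R -> R) n : (forall k, continuous (f k)) ->
  continuous (fun z => \sum_(k < n) f k z).
Proof.
move=> cf; elim: n => [|n IH].
  have -> : (fun z => \sum_(k < 0) f k z) = cst 0 by apply/funext => z; rewrite big_ord0.
  exact: cst_continuous.
have -> : (fun z => \sum_(k < n.+1) f k z) = (fun z => \sum_(k < n) f k z + f n z).
  by apply/funext => z; rewrite big_ord_recr.
by move=> z; apply: cvgD; [exact: IH|exact: cf].
Qed.

Lemma continuous_off_diagonal x K : continuous (off_diagonal x K).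
Proof.
have ctrig (g : R -> R) k : continuous g -> continuous (fun tau : R => dirichlet_weight x k * g (tau * ln k.+1%:R)).
  move=> cg tau; apply: cvgM; first exact: cvg_cst.
  apply: (@continuous_comp _ _ _ (fun tau : R => tau * ln k.+1%:R) g); last exact: cg.
  by apply: cvgM => //; exact: cvg_cst.
move=> tau; rewrite /off_diagonal /dirichlet_sqr.
have csq (f : R -> R) : continuous f -> continuous (fun tau => f tau ^+ 2).
  move=> cf z; apply: (@continuous_comp _ _ _ f (fun y : R => y ^+ 2)); first exact: cf.
  exact: exprn_continuous.
apply: cvgB; last exact: cvg_cst.
apply: cvgD; apply: csq.
- apply: (@continuous_sum_ord (fun k tau => dirichlet_weight x k * cos (tau * ln k.+1%:R))) => k.
  by apply: ctrig; exact: continuous_cos.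
- apply: (@continuous_sum_ord (fun k tau => dirichlet_weight x k * sin (tau * ln k.+1%:R))) => k.
  by apply: ctrig; exact: continuous_sin.
Qed.

(** * The mean square for a fixed degree and a fixed point x + i t *)

Section fixed_parameters.
Variables (e : nat) (x t : R).
Local Notation T := (measurableTypeR R).
(** Here d = e + 1. For x >= 1/2, n^(-x Q) is at most n^(-(d + 1)), which outweighs the growth n^d
    of the phase. *)
Let Q := (2 * e.+2)%N.

(** The part of tau at n + 1 that does not involve a_1: entry j of the tuple is the coefficient a_(j
    + 2). *)
Definition tail_phase (a : e.-tuple T) n : R :=
  t + \sum_(j < e) (tnth a j : R) * n.+1%:R ^+ j.+2.

Definition off_diagonal_mean j (p : T * e.-tuple T) : R :=
  (j.+1 ^ 4)%N%:R^-1 *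
    \sum_(n < j.+1 ^ 4) off_diagonal x (n.+1 ^ Q) (tail_phase p.2 n + (p.1 : R) * n.+1%:R).

Lemma measurable_off_diagonal_mean j : measurable_fun setT (off_diagonal_mean j).
Proof.
apply: measurable_funM; first exact: measurable_cst.
apply: measurable_sum => n.
apply: (@measurableT_comp _ _ _ _ _ _ (off_diagonal x (n.+1 ^ Q))).
  apply: continuous_measurable_fun.
  exact: continuous_off_diagonal.
apply: measurable_funD; last first.
  by apply: measurable_funM; [exact: measurable_fst|exact: measurable_cst].
apply: measurable_funD; first exact: measurable_cst.
apply: measurable_sum => i; apply: measurable_funM; last exact: measurable_cst.
apply: (@measurableT_comp _ _ _ _ _ _ (fun a : e.-tuple T => tnth a i)) => //.
exact: measurable_tnth.
Qed.

Lemma continuous_off_diagonal_mean j a : continuous (fun y : R => off_diagonal_mean j (y, a)).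
Proof.
move=> y; apply: cvgM; first exact: cvg_cst.
apply: (@continuous_sum_ord (fun n y => off_diagonal x (n.+1 ^ Q) (tail_phase a n + y * n.+1%:R))) => n {}y.
apply: (@continuous_comp _ _ _ (fun y : R => tail_phase a n + y * n.+1%:R)); last exact: continuous_off_diagonal.
apply: cvgD; first exact: cvg_cst.
by apply: cvgM => //; exact: cvg_cst.
Qed.

Hypothesis x_itv : threshold e.+1 < x <= 1.

Let x_gt : 2^-1 < x.
Proof. by have /andP[h _] := threshold_itv e.+1; case/andP: x_itv => h2 _; exact: lt_trans h2. Qed.

Let x_le1 : x <= 1.
Proof. by case/andP: x_itv. Qed.

Let Q_small : 16 * Q%:R * (1 - x) <= 1.
Proof.
case/andP: x_itv => h _; rewrite /threshold in h.
have -> : 16 * Q%:R = (32 * e.+2)%N%:R :> R by rewrite -natrM; congr (_%:R); rewrite /Q; lia.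
set m := (32 * e.+2)%N%:R in h *.
have m0 : 0 < m :> R by rewrite ltr0n.
by rewrite -ler_pdivlMl // mulr1; move: m^-1 h => c; lra.
Qed.

Lemma off_diagonal_mean_cvg_ae : exists Z : set (T * e.-tuple T),
  [/\ measurable Z, (@lebesgue_measure R \x lebesgue_tuple R e)%E Z = 0%E &
    forall y a, ~ Z (y, a) -> 0 <= (y : R) ->
      0 < (y : R) /\ (fun j => off_diagonal_mean j (y, a)) @ \oo --> (0 : R)].
Proof.
apply: (@osc_int_cvg_ae R _ _ (lebesgue_tuple R e) off_diagonal_mean
  (fun A j => (A.+1%:R + 32) * (1 + 20 * Q%:R) ^+ 5 * expR (- (1 + 1) * ln j.+1%:R))).
- exact: measurable_off_diagonal_mean.
- exact: continuous_off_diagonal_mean.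
- move=> A j a; exact: (@osc_int_off_diagonal_mean R x A.+1%:R Q j (tail_phase a) _ _ x_le1 Q_small).
- move=> A; exact: (@is_cvg_seriesZ R _ ((A.+1%:R + 32) * (1 + 20 * Q%:R) ^+ 5) (inv_power_series_cvg ltr01)).
Qed.

Variable zeta : R[i] -> R[i].
Hypothesis zetaP : is_riemann_zeta zeta.

(** The modulus as an element of [R]; the norm on [R[i]] takes its values in [R[i]]. *)
Let cmod (z : R[i]) : R := Num.sqrt (complex.Re z ^+ 2 + complex.Im z ^+ 2).

Lemma dirichlet_sqr_ge0 K tau : 0 <= dirichlet_sqr x K tau.
Proof. by rewrite addr_ge0 // sqr_ge0. Qed.

Lemma zeta_cmod_approx T n : 1 <= `|T| ->
  `|cmod (zeta (x +i* T)) - Num.sqrt (dirichlet_sqr x n.+1 T)| <=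
  2 * (2 / `|T| * expR ((1 - x) * ln n.+2%:R) + 144 * `|T| * expR (- x * ln n.+1%:R)).
Proof.
move=> T1.
have xi : 2^-1 <= x <= 1 by rewrite (ltW x_gt) x_le1.
have h1 := @zeta_component_approx R zeta zetaP 1 0 T x n xi T1.
have h2 := @zeta_component_approx R zeta zetaP 0 1 T x n xi T1.
rewrite !normr1 !normr0 ?addr0 ?add0r lexx in h1 h2.
have {}h1 := h1 isT; have {}h2 := h2 isT.
have -> : cmod (zeta (x +i* T)) = Num.sqrt (component 1 0 (zeta (x +i* T)) ^+ 2 + component 0 1 (zeta (x +i* T)) ^+ 2).
  by rewrite /cmod /component; congr Num.sqrt; ring.
have -> : dirichlet_sqr x n.+1 T = series (fun k => oscpow x 1 0 T (fun=> 1) k.+1%:R) n.+1 ^+ 2 +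
    series (fun k => oscpow x 0 1 T (fun=> 1) k.+1%:R) n.+1 ^+ 2.
  rewrite /dirichlet_sqr /series /= !big_mkord; congr (_ ^+ 2 + _ ^+ 2); apply: eq_bigr => k _.
  - by rewrite /oscpow /dirichlet_weight; ring.
  - by rewrite /oscpow /dirichlet_weight; ring.
apply: le_trans (sqrt_sqrD_dist _ _ _ _) _; lra.
Qed.

Definition phase (y : R) (a : e.-tuple T) n : R := tail_phase a n + y * n.+1%:R.

(** Nonnegative coefficients prevent cancellation, so for large n the phase lies between y n / 2 and
    C1 n^d. With K = n^Q the errors are O(n^(Q (1 - x) - 1)), where Q (1 - x) <= 1/16, and O(n^(d -
    x Q)); both are bounded by a multiple of n^(-1/2). *)
Lemma zeta_cmod_approx_cvg0 (y : R) a : 0 < y -> (forall j, 0 <= (tnth a j : R)) ->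
  (fun n => cmod (zeta (x +i* phase y a n)) - Num.sqrt (dirichlet_sqr x (n.+1 ^ Q) (phase y a n)))
    @ \oo --> (0 : R).
Proof.
move=> y0 a0.
pose C1 := `|t| + \sum_(j < e) (tnth a j : R) + y.
have S0 : 0 <= \sum_(j < e) (tnth a j : R) by exact: sumr_ge0.
have C10 : 0 <= C1 by rewrite !addr_ge0 // ltW.
pose C := 2 * (8 / y + 144 * C1).
have C0 : 0 <= C.
  apply: mulr_ge0; first exact: ler0n.
  apply: addr_ge0; first by apply: divr_ge0; [exact: ler0n|exact: ltW].
  by apply: mulr_ge0; first exact: ler0n.
have half : 0 < 2^-1 :> R by rewrite invr_gt0.
(* From here on y (n + 1) / 2 >= |t| + 1, which absorbs t and makes the phase at least 1. *)
have main n : 2 * (`|t| + 1) / y <= n.+1%:R ->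
   `|cmod (zeta (x +i* phase y a n)) - Num.sqrt (dirichlet_sqr x (n.+1 ^ Q) (phase y a n))| <=
     C * expR (- 2^-1 * ln n.+1%:R).
  rewrite ler_pdivrMr // => hn.
  pose l : R := ln n.+1%:R.
  have l0 : 0 <= l by rewrite ln_ge0 // ler1n.
  have nE : n.+1%:R = expR l by rewrite lnK ?posrE.
  have n1 : 1 <= n.+1%:R :> R by rewrite ler1n.
  have s0 : 0 <= \sum_(j < e) (tnth a j : R) * n.+1%:R ^+ j.+2.
    by apply: sumr_ge0 => j _; rewrite mulr_ge0 // exprn_ge0.
  have lo : y / 2 * n.+1%:R <= `|phase y a n|.
    have tb : - `|t| <= t by rewrite lerNl -normrN ler_norm.
    apply: le_trans (ler_norm _); rewrite /phase /tail_phase.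
    move: (\sum_(j < e) _) s0 => s s0; lra.
  have T1 : 1 <= `|phase y a n|.
    apply: le_trans lo; have := normr_ge0 t; lra.
  have hi : `|phase y a n| <= C1 * n.+1%:R ^+ e.+1.
    rewrite /phase /tail_phase /C1 !mulrDl.
    apply: le_trans (ler_normD _ _) _; apply: lerD; last first.
      rewrite normrM !ger0_norm ?(ltW y0) // ler_wpM2l ?(ltW y0) //.
      by rewrite -[leLHS]expr1 ler_weXn2l.
    apply: le_trans (ler_normD _ _) _; apply: lerD.
      by rewrite ler_peMr // exprn_ege1.
    rewrite ger0_norm // mulr_suml; apply: ler_sum => j _; rewrite ler_wpM2l // ler_weXn2l //.
    exact: ltn_ord.
  have K0 : (0 < n.+1 ^ Q)%N by rewrite expn_gt0.
  have h := zeta_cmod_approx (n.+1 ^ Q).-1 T1.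
  rewrite (prednK K0) in h; apply: le_trans h _.
  have lK : ln (n.+1 ^ Q)%N%:R = Q%:R * l :> R by rewrite natrX nE -expRM_natl expRK.
  have lK2 : ln (n.+1 ^ Q).+1%:R <= ln 2 + Q%:R * l :> R.
    rewrite -lK -lnM ?posrE ?ltr0n // ler_ln ?posrE ?mulr_gt0 ?ltr0n // -natrM ler_nat.
    by rewrite mul2n -addnn -addn1 leq_add2l.
  rewrite lK.
  have b1 : 2 / `|phase y a n| * expR ((1 - x) * ln (n.+1 ^ Q).+1%:R) <= 8 / y * expR (- 2^-1 * l).
    have -> : 8 / y * expR (- 2^-1 * l) = (2 / (y / 2 * n.+1%:R)) * (2 * expR (2^-1 * l)).
      have -> : expR (- 2^-1 * l) = expR (2^-1 * l) / n.+1%:R.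
        by rewrite nE -expRN -expRD; congr expR; field.
      have yn : y != 0 by rewrite gt_eqF.
      have nn : n.+1%:R != 0 :> R by rewrite pnatr_eq0.
      by move: n.+1%:R nn => m m0; field; rewrite m0 yn.
    apply: ler_pM; rewrite ?expR_ge0 ?divr_ge0 //.
      have yp : 0 < y / 2 * n.+1%:R by rewrite mulr_gt0 ?ltr0n // divr_gt0.
      have Tp : 0 < `|phase y a n| by exact: lt_le_trans ltr01 T1.
      by apply: ler_wpM2l => //; rewrite lef_pV2 ?posrE.
    have -> : 2 * expR (2^-1 * l) = expR (ln 2 + 2^-1 * l) by rewrite expRD lnK ?posrE.
    rewrite ler_expR.
    have x1 : 0 <= 1 - x by rewrite subr_ge0.
    have l2 : 0 <= ln 2 :> R by rewrite ln_ge0 // ler1n.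
    have g1 := ler_wpM2l x1 lK2.
    have g2 := ler_wpM2r l0 Q_small.
    have g3 : (1 - x) * ln 2 <= 1 * ln 2.
      by rewrite ler_wpM2r //; have := x_gt; lra.
    lra.
  have b2 : 144 * `|phase y a n| * expR (- x * (Q%:R * l)) <= 144 * C1 * expR (- 2^-1 * l).
    rewrite -!mulrA; apply: ler_wpM2l; first exact: ler0n.
    apply: (@le_trans _ _ (C1 * n.+1%:R ^+ e.+1 * expR (- x * (Q%:R * l)))).
      by rewrite ler_wpM2r // expR_ge0.
    rewrite -mulrA ler_wpM2l // nE -expRM_natl -expRD ler_expR.
    have QE : Q%:R = 2 * (e.+1%:R + 1) :> R by rewrite /Q natrM natr1.
    have : 2^-1 * (Q%:R * l) <= x * (Q%:R * l) by rewrite ler_wpM2r ?mulr_ge0 // ltW.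
    rewrite QE; have : 0 <= e.+1%:R * l :> R by rewrite mulr_ge0.
    lra.
  rewrite /C -[leRHS]mulrA; apply: ler_wpM2l; first exact: ler0n.
  by rewrite [leRHS]mulrDl; exact: lerD.
have key : (fun n => C * expR (- 2^-1 * ln n.+1%:R)) @ \oo --> (0 : R).
  rewrite -[X in _ --> X](mulr0 C); apply: cvgM; first exact: cvg_cst.
  exact: inv_power_cvg0.
move/cvg_epsP: key => key; apply/cvg_epsP => eps eps0; have [N HN] := key eps eps0.
exists (maxn N (Num.truncn (2 * (`|t| + 1) / y))) => n; rewrite geq_max => /andP[nN nt].
have := HN n nN; rewrite !sub0r !normrN => h.
apply: le_trans (le_trans (ler_norm _) h).
apply: main; apply: le_trans (ltW (truncnS_gt _)) _; by rewrite ler_nat.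
Qed.

Let x_half : 1 < 2 * x.
Proof. have h := x_gt; lra. Qed.

Lemma zeta_2x_real : zeta (2 * x)%:C = (complex.Re (zeta (2 * x)%:C))%:C.
Proof.
have h := @zeta_component_series R zeta zetaP 0 1 0 (2 * x) x_half.
have : component 0 1 (zeta (2 * x)%:C) = 0.
  apply: (cvg_unique (@Rhausdorff R) h).
  have -> : series (fun k => oscpow (2 * x) 0 1 0 (fun=> 1) k.+1%:R) = cst 0.
    apply/funext => n; rewrite /series /= big1 // => k _.
    by rewrite /oscpow !mul0r sin0 mulr0 addr0 mulr0 mul0r.
  exact: cvg_cst.
case: (zeta _) => u v; rewrite /component /= mul0r mul1r sub0r => /eqP.
by rewrite oppr_eq0 => /eqP ->.
Qed.

Lemma sum_sqr_weight_cvg :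
  series (fun k => dirichlet_weight x k ^+ 2) @ \oo --> complex.Re (zeta (2 * x)%:C).
Proof.
have := @zeta_component_series R zeta zetaP 1 0 0 (2 * x) x_half.
rewrite {1}/component mul1r mul0r subr0.
have -> // : series (fun k => oscpow (2 * x) 1 0 0 (fun=> 1) k.+1%:R) = series (fun k => dirichlet_weight x k ^+ 2).
apply/funext => n; rewrite /series /=; apply: eq_bigr => k _.
rewrite /oscpow mul0r cos0 sin0 /dirichlet_weight expr2 -expRD mulr0 addr0 !mulr1.
by congr expR; ring.
Qed.

Lemma zeta_mean_square (y : R) a : 0 < y -> (forall j, 0 <= (tnth a j : R)) ->
  (fun j => off_diagonal_mean j (y, a)) @ \oo --> (0 : R) ->
  (fun N => N%:R^-1 * series (fun n => cmod (zeta (x +i* phase y a n)) ^+ 2) N) @ \oo -->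
    complex.Re (zeta (2 * x)%:C).
Proof.
move=> y0 a0 hY; set L := complex.Re _.
pose X n := dirichlet_sqr x (n.+1 ^ Q) (phase y a n).
pose dg n := series (fun k => dirichlet_weight x k ^+ 2) (n.+1 ^ Q)%N.
have dgL : dg @ \oo --> L.
  have /cvg_epsP h := sum_sqr_weight_cvg; apply/cvg_epsP => eps eps0.
  have [N HN] := h eps eps0; exists N => n Nn; apply: HN.
  apply: leq_trans Nn (leq_trans (leqnSn n) _).
  by rewrite -{1}[n.+1]expn1 leq_pexp2l.
apply: (@mean_sqr_perturb R (fun n => Num.sqrt (X n))).
- by move=> n; exact: sqrtr_ge0.
- exact: zeta_cmod_approx_cvg0.
have -> : (fun n => Num.sqrt (X n) ^+ 2) = X.
  by apply/funext => n; rewrite sqr_sqrtr // dirichlet_sqr_ge0.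
(* The reduction to N = j^4 is made for X, which is nonnegative, and not for its off-diagonal part,
   whose partial sums need not be monotone. *)
apply: mean_cvg_fourth_powers; first by move=> n; exact: dirichlet_sqr_ge0.
have -> : (fun j => (j.+1 ^ 4)%N%:R^-1 * series X (j.+1 ^ 4)%N) =
   (fun j => off_diagonal_mean j (y, a) + (j.+1 ^ 4)%N%:R^-1 * series dg (j.+1 ^ 4)%N).
  apply/funext => j; rewrite /off_diagonal_mean -mulrDr; congr (_ * _).
  rewrite /series /= !big_mkord -big_split /=; apply: eq_bigr => n _.
  by rewrite /off_diagonal /dg /series /= big_mkord subrK.
rewrite -[X in _ --> X]add0r; apply: cvgD => //.
have /cvg_epsP h := mean_cvg dgL; apply/cvg_epsP => eps eps0.
have [N HN] := h eps eps0; exists N => n Nn; apply: HN.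
apply: leq_trans Nn (leq_trans (leqnSn n) _).
by rewrite -{1}[n.+1]expn1 leq_pexp2l.
Qed.

Lemma zeta_mean_square_complex (a : e.+1.-tuple T) : 0 < (thead a : R) ->
  (forall j, 0 <= (tnth a j : R)) ->
  (fun j => off_diagonal_mean j (tuple_uncons a)) @ \oo --> (0 : R) ->
  ((N%:R^-1 * \sum_(1 <= n < N.+1)
    `|zeta ((x +i* t) +
       (0 +i* 1) * (\sum_(j < e.+1) (tnth a j : R) * n%:R ^+ j.+1)%:C)| ^+ 2)
     : R[i]^o) @[N --> \oo] --> (zeta (2 * x)%:C : R[i]^o).
Proof.
move=> a1 a0 hY.
have a0' j : 0 <= (tnth [tuple of behead a] j : R).
  by rewrite tnth_behead; exact: a0.
have h := zeta_mean_square a1 a0' hY.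
rewrite zeta_2x_real.
have -> : (fun N : nat => (N%:R^-1 * \sum_(1 <= n < N.+1)
    `|zeta ((x +i* t) + (0 +i* 1) * (\sum_(j < e.+1) (tnth a j : R) * n%:R ^+ j.+1)%:C)| ^+ 2 : R[i])) =
   (fun N => (N%:R^-1 * series (fun n => cmod (zeta (x +i* phase (thead a) [tuple of behead a] n)) ^+ 2) N)%:C).
  apply/funext => N; rewrite rmorphM fmorphV rmorph_nat /series /= rmorph_sum /= big_add1 /=.
  congr (_ * _); apply: eq_bigr => n _; rewrite rmorphXn /=.
  have -> : (x +i* t) + (0 +i* 1) * (\sum_(j < e.+1) (tnth a j : R) * n.+1%:R ^+ j.+1)%:C =
      x +i* phase (thead a) [tuple of behead a] n.
    apply/eqP; rewrite eq_complex /=; apply/andP; split; apply/eqP; first by ring.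
    rewrite big_ord_recl /= expr1 /phase /tail_phase.
    under [in RHS]eq_bigr do rewrite tnth_behead.
    have -> : tnth a ord0 = thead a by [].
    rewrite mul0r mul1r add0r [X in _ + X]addrC addrA; congr (_ + _ + _).
    apply: eq_bigr => j _; congr (tnth a _ * _ ^+ _); apply/val_inj.
    by rewrite /= inordK // ltnS; exact: (ltn_ord j).
  by rewrite normc_def.
apply/cvgrPdist_le => eps eps0.
have e1 : 0 < complex.Re eps by case: eps eps0 => u v; rewrite ltcE /= => /andP[].
have eE : eps = (complex.Re eps)%:C by case: eps eps0 {e1} => u v; rewrite ltcE /= => /andP[/eqP -> _].
move/cvg_epsP: h => /(_ _ e1)[N HN]; exists N => // n /= Nn.
rewrite -rmorphB normc_def /= expr0n addr0 sqrtr_sqr eE lecR; exact: HN.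
Qed.

End fixed_parameters.

End mean_square.

Theorem theorem1 (R : realType) (zeta : R[i] -> R[i])
    (zetaP : is_riemann_zeta zeta) :
  exists S_ : nat -> R,
    [/\ computable_real_seq S_,
        S_ n @[n --> \oo] --> (1 : R)
      & forall d : nat, (2 <= d)%N ->
        2^-1 < S_ d < 1 /\
        forall sigma t : R, S_ d < sigma <= 1 ->
        {ae lebesgue_tuple R d, forall a : d.-tuple (measurableTypeR R),
          (forall j, (0 : R) <= tnth a j) ->
          ((N%:R^-1 * \sum_(1 <= n < N.+1)
             `|zeta ((sigma +i* t) +
                 (0 +i* 1) * (\sum_(j < d) (tnth a j : R) * n%:R ^+ j.+1)%:C)| ^+ 2)
             : R[i]^o) @[N --> \oo] --> (zeta (2 * sigma)%:C : R[i]^o)}].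
Proof.
exists (threshold R); split; [exact: threshold_computable|exact: threshold_cvg|].
move=> d d2; split; first exact: threshold_itv.
move=> sigma t; case: d d2 => // e _ hs.
have [Z [mZ Z0 hZ]] := off_diagonal_mean_cvg_ae t hs.
(* [lebesgue_cons] is a pushforward along [tuple_cons], so by [tuple_consK] this preimage has the
   product measure of Z. *)
exists (@tuple_uncons R e @^-1` Z); split.
- rewrite -[X in measurable X]setTI; exact: measurable_tuple_uncons.
- rewrite -[RHS]Z0 /= /lebesgue_cons /pushforward; congr (_ _).
  by apply/seteqP; split => p; rewrite /= tuple_consK.
- move=> a /= na; apply: contrapT => nZ; apply: na => a0.
  have [a1 hY] := hZ (thead a) [tuple of behead a] nZ (a0 ord0).
  exact: (zeta_mean_square_complex hs zetaP a1 a0 hY).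
Qed.
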